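(* Let $0<\alpha<1$ and let $r\in\mathbb{N}$ be a positive integer. (i) Let $(R_i,i\ge1)$ be a sequence of independent random variables with $R_i\sim$ Beta$((r+i)\alpha,1)$. Define $$V_n^{(r)}:=\frac{\prod_{i=1}^{n-1}R_i}{1+R_1+R_1R_2+\cdots}=Y_n\prod_{i=1}^{n-1}(1-Y_i),\quad n\ge1,$$ with stick-breaking factors $Y_n=(1+\Sigma_n)^{-1}$ and $\Sigma_n=R_n+R_nR_{n+1}+R_nR_{n+1}R_{n+2}+\cdots$. Then $(V_n^{(r)},n\ge1)$ has law $\mathbf{PD}_\alpha^{(r)}$. (ii) Let $(V_i^{(r)})$ be distributed as $\mathbf{PD}_\alpha^{(r)}$ and $(V_i)$ be distributed as $\mathbf{PD}(\alpha,0)$. Then for any nonnegative measurable function $f$, $$\mathbb{E}\{f(V_1^{(r)},V_2^{(r)},\ldots)\}=\mathbb{E}\Big\{\frac{\mathfrak{E}_1^r}{r!}\,f(V_1,V_2,\ldots)\Big\},$$ where $\mathfrak{E}_1=\lim_{n\to\infty}nV_n^\alpha/V_1^\alpha$, and the limit holds almost surely and in $p$th mean for all $p\ge1$.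
   Context: Let $\rho_\alpha(x)=C\alpha x^{-\alpha-1}$, $x>0$, for some $C>0$, and let $(S_t)_{0\le t\le1}$ be a driftless $\alpha$-stable subordinator with Lévy density $\rho_\alpha$, with ranked jumps $\Delta_1>\Delta_2>\cdots$ on $[0,1]$ (the points of a Poisson point process on $(0,\infty)$ with intensity $\rho_\alpha(x)dx$), so $S_1=\sum_i\Delta_i$. $\mathbf{PD}(\alpha,0)$ is the law of $(\Delta_1/S_1,\Delta_2/S_1,\ldots)$. With ${}^{(r)}S_1=S_1-\sum_{i=1}^r\Delta_i$, $\mathbf{PD}_\alpha^{(r)}$ is the law of $(\Delta_{r+1}/{}^{(r)}S_1,\Delta_{r+2}/{}^{(r)}S_1,\ldots)$. These laws do not depend on $C$. Beta$(a,1)$ has density $a u^{a-1}$ on $(0,1)$. Empty products equal $1$. *)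

(* Defs.v *)
From HB Require Import structures.
From mathcomp Require Import all_boot all_order all_algebra finmap.
From mathcomp Require Import all_classical all_reals all_analysis.
From mathcomp Require Import measurable_realfun.

Set Implicit Arguments.
Unset Strict Implicit.
Unset Printing Implicit Defensive.

Import Order.TTheory GRing.Theory Num.Theory.
Import numFieldNormedType.Exports.

Local Open Scope classical_set_scope.
Local Open Scope ring_scope.

(* The space of real sequences with the product sigma-algebra, generated by the
   coordinate maps. Sequences are indexed from 0, so that the [n]-th term of a
   sequence written [x_1, x_2, ...] on paper is [x n.-1]. *)
Definition seq_cylinder (R : realType) : set (set (nat -> R)) :=
  \bigcup_n preimage_set_system setT (fun x : nat -> R => x n) measurable.
Arguments seq_cylinder : clear implicits.

Notation seqs R := (g_sigma_algebraType (seq_cylinder R)).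

Section laws.
Context d (T : measurableType d) (R : realType) (P : probability T R).

Definition has_law d' (T' : measurableType d') (X : T -> T')
    (mu : probability T' R) :=
  measurable_fun setT X /\
  forall A, measurable A -> P (X @^-1` A) = mu A.

Definition independent (I : choiceType) d' (T' : measurableType d')
    (X : I -> T -> T') :=
  forall (J : {fset I}) (B : I -> set T'), (forall i, measurable (B i)) ->
    P (\bigcap_(i in [set` J]) (X i @^-1` B i)) =
    (\prod_(i <- J) P (X i @^-1` B i))%E.

Definition beta1_law (a : R) (X : T -> R) :=
  forall B : set R, measurable B ->
    P (X @^-1` B) =
    (\int[lebesgue_measure]_(x in B `&` `]0%R, 1%R[) (a * x `^ (a - 1))%:E)%E.

(* The Poisson law with mean [lam] in [0, +oo], for an extended real variable;
   mean +oo means that [X] is a.s. infinite. The second argument of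
   [poisson_prob] is unused by the library. *)
Definition poisson_law (lam : \bar R) (X : T -> \bar R) :=
  if lam is l%:E then
    forall k : nat,
      P [set w | X w = k%:R%:E] = poisson_prob l 0%N [set k]
  else P [set w | X w = +oo%E] = 1%E.

(* The number N(A) of points of the configuration [Delta] that fall in [A]. *)
Definition point_count (Delta : nat -> T -> R) (A : set R) (w : T) : \bar R :=
  (\sum_(n <oo) \d_(Delta n w) A)%E.

(* [Delta] lists in decreasing order the points of a Poisson point process on
   (0, +oo) with intensity measure [Lam]. *)
Definition ranked_ppp (Lam : set R -> \bar R) (Delta : nat -> T -> R) :=
  [/\ {ae P, forall w, forall n, 0 < Delta n.+1 w < Delta n w},
      forall A : set R, measurable A -> A `<=` `]0, +oo[ ->
        poisson_law (Lam A) (point_count Delta A)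
    & forall A : nat -> set R,
        (forall j, measurable (A j)) -> (forall j, A j `<=` `]0, +oo[) ->
        trivIset setT A ->
        independent (fun j => point_count Delta (A j))].

Definition stable_density (C alpha x : R) : R := C * alpha * x `^ (- alpha - 1).

Definition stable_intensity (C alpha : R) (A : set R) : \bar R :=
  (\int[lebesgue_measure]_(x in A) (stable_density C alpha x)%:E)%E.

Definition stable_jumps (C alpha : R) (Delta : nat -> T -> R) :=
  ranked_ppp (stable_intensity C alpha) Delta.

End laws.

Section measurability.
Context d (T : measurableType d) (R : realType).

Lemma measurable_cvgn (h : nat -> T -> R) :
  (forall n, measurable_fun setT (h n)) ->
  measurable [set w | cvgn (h ^~ w)].
Proof.
move=> mh.
have -> : [set w | cvgn (h ^~ w)] = \bigcap_k \bigcup_N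
    \bigcap_(m in [set m | (N <= m)%N]) \bigcap_(n in [set n | (N <= n)%N])
      ((fun w => `|h m w - h n w|) @^-1` `]-oo, k.+1%:R^-1[).
  apply/seteqP; split => w /=.
    move=> /cauchy_cvgP /cauchyP H k _.
    have [M] := H k.+1%:R^-1 (ltac:(by rewrite invr_gt0)).
    have k0 : (0 : R) < k.+1%:R^-1 / 2 by rewrite divr_gt0 ?invr_gt0.
    have [M'] := H _ k0; rewrite /fmap /= => -[N _ HN] _.
    exists N => // m Nm n Nn; rewrite /= in_itv /=.
    have := HN m Nm; have := HN n Nn; rewrite /ball /= => H1 H2.
    rewrite [ltRHS](splitr).
    apply: le_lt_trans (ltrD H2 H1).
    rewrite (_ : h m w - h n w = - (M' - h m w) + (M' - h n w)); last first.
      by rewrite opprB addrA subrK.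
    by rewrite (le_trans (ler_normD _ _))// normrN.
  move=> H; apply/cauchy_cvgP/cauchyP => e e0.
  have [k _ ke] : \forall k \near \oo, k.+1%:R^-1 < e by exact: near_infty_natSinv_lt (PosNum e0).
  have [N _ HN] := H k I.
  exists (h N w); rewrite /fmap /=; exists N => // n /= Nn.
  have := HN N (leqnn N) n Nn; rewrite /= in_itv /= /ball /= => /lt_trans; apply.
  exact: ke (leqnn k).
apply: bigcapT_measurable => k; apply: bigcupT_measurable => N.
apply: bigcap_measurableType => m _; apply: bigcap_measurableType => n _.
rewrite -[X in measurable X]setTI.
have : measurable_fun setT (fun w => `|h m w - h n w|).
  by apply: measurableT_comp => //; exact: measurable_funB.
by apply.
Qed.

Lemma measurable_fun_limn (h : nat -> T -> R) :
  (forall n, measurable_fun setT (h n)) ->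
  measurable_fun setT (fun w => limn (h ^~ w)).
Proof.
move=> mh; pose D := [set w | cvgn (h ^~ w)].
have mD : measurable D by exact: measurable_cvgn.
rewrite -(setvU D); apply/measurable_funU => //; first exact: measurableC.
split.
- apply: (eq_measurable_fun (fun=> (point : R))) => [w|]; last exact: measurable_cst.
  by rewrite inE => /= /dvgP ->.
- apply: (measurable_fun_cvg (h := h)) => // n; exact: measurable_funTS.
Qed.

Lemma measurable_invr : measurable_fun setT (@GRing.inv R).
Proof.
rewrite -(setvU [set (0 : R)]).
apply/measurable_funU; [exact: measurableC|by []|].
split; last exact: measurable_fun_set1.
apply: open_continuous_measurable_fun; first exact/closed_openC/closed_eq.
by move=> x; rewrite inE /= => /eqP x0; exact: inv_continuous.
Qed.

Lemma measurable_seqs_coord n : measurable_fun setT (fun x : seqs R => x n).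
Proof.
move=> _ B mB; rewrite setTI; apply: sub_sigma_algebra.
by exists n => //; exists B => //; rewrite setTI.
Qed.

Lemma measurable_fun_seqs (X : T -> seqs R) :
  (forall n, measurable_fun setT (fun w => X w n)) -> measurable_fun setT X.
Proof.
move=> mX; apply: (@measurability _ _ _ _ setT X (seq_cylinder R)) => // _ [_ [n _ [B mB <-]] <-].
by rewrite setTI; exact: (mX n).
Qed.

End measurability.

Section trimmed.
Context d (T : measurableType d) (R : realType) (P : probability T R).

Definition jump_sum (Delta : nat -> {RV P >-> R}) (w : T) : R :=
  limn (series (fun n => Delta n w)).

(* The sequence (Delta_{r+1}, Delta_{r+2}, ...) / {}^{(r)}S_1 *)
Definition trimmed_ratio (Delta : nat -> {RV P >-> R}) (r : nat) (w : T) :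
    seqs R :=
  fun n => Delta (r + n)%N w / (jump_sum Delta w - \sum_(i < r) Delta i w).

Lemma measurable_trimmed_ratio (Delta : nat -> {RV P >-> R}) (r : nat) :
  measurable_fun setT (trimmed_ratio Delta r).
Proof.
apply: measurable_fun_seqs => n; rewrite /trimmed_ratio.
apply: measurable_funM => //; apply: measurableT_comp; first exact: measurable_invr.
apply: measurable_funB; last exact: measurable_sum.
apply: measurable_fun_limn => m.
exact: measurable_sum.
Qed.

HB.instance Definition _ (Delta : nat -> {RV P >-> R}) (r : nat) :=
  isMeasurableFun.Build _ _ _ _ (trimmed_ratio Delta r)
    (measurable_trimmed_ratio Delta r).

(* For [Delta] with [stable_jumps P C alpha Delta], this is PD_alpha^(r); for
   [r = 0] nothing is trimmed and it is PD(alpha, 0). *)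
Definition PD (Delta : nat -> {RV P >-> R}) (r : nat) : probability (seqs R) R :=
  distribution P (trimmed_ratio Delta r).

End trimmed.

Section sequences.
Context (R : realType).
Implicit Types x v : nat -> R.

(* The terms of Sigma_n = x_n + x_n x_{n+1} + x_n x_{n+1} x_{n+2} + ... *)
Definition Sigma_term x (n k : nat) : R := \prod_(n <= i < n + k.+1) x i.

Definition Sigma x (n : nat) : R := limn (series (Sigma_term x n)).

Definition stick_factor x (n : nat) : R := (1 + Sigma x n)^-1.

Definition stick_seq x : seqs R :=
  fun n => (\prod_(i < n) x i) / (1 + Sigma x 0).

(* n V_n^alpha / V_1^alpha, with [v n] standing for V_{n+1} *)
Definition frakE_approx (alpha : R) v (n : nat) : R :=
  n.+1%:R * v n `^ alpha / v 0%N `^ alpha.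

Definition frakE (alpha : R) v : R := limn (frakE_approx alpha v).

End sequences.

(* Main.v *)
Require Import Defs.
From HB Require Import structures.
From mathcomp Require Import all_boot all_order all_algebra finmap.
From mathcomp Require Import all_classical all_reals all_analysis.
From mathcomp Require Import measurable_realfun.
From mathcomp Require Import ring lra zify.

Set Implicit Arguments.
Unset Strict Implicit.
Unset Printing Implicit Defensive.

Import Order.TTheory GRing.Theory Num.Theory.
Import numFieldNormedType.Exports.

Local Open Scope classical_set_scope.
Local Open Scope ring_scope.

(* The ratios Q_i = Delta_{i+1} / Delta_i are independent Beta(i alpha, 1): on
   a geometric grid, the probability that Delta_1, ..., Delta_m fall in given
   cells factorizes by independence of the Poisson counts of the cells and of
   the gaps between them, and summing geometric series gives the exact joint
   law of the discretized ratios; the mesh then tends to 0.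

   Part (i): the trimmed sequence is the stick-breaking sequence of
   Q_{r+1}, Q_{r+2}, ..., whose sum has finite mean, by telescoping.

   Part (ii): Y_n = n (V_n / V_1)^alpha = n prod_{i < n} Q_i^alpha satisfies
   E (Y_n - Y_m)^2 <= 2 / (m + 1) for m <= n, so it converges almost surely
   along a sparse subsequence, and then along all n because the product is
   monotone; bounded moments give convergence in every L^p.  Multiplying the
   densities of Q_1, ..., Q_m by Q_i^(r alpha) (up to constants) turns
   Beta(i alpha, 1) into Beta((r + i) alpha, 1), and the product of these
   factors is a multiple of Y_m^r; let m tend to infinity. *)

(** * Measure and integration tools *)

(** The Poisson hypothesis speaks of counts in fixed sets, not of points by rank, so events on
    [Delta i] must first be rewritten as events on counts of disjoint intervals. A geometric grid
    suits a power intensity: the cell from exp(h k) to exp(h (k + 1)) has mean proportional to exp(-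
    alpha h k), and differences of cell indices measure the logarithms of the ratios. The sum over
    the lowest cell index is never evaluated: the gaps enter through an explicit factor in front of
    the probability that all gaps are at least one cell, and that probability tends to 1 with the
    mesh because the points are distinct. [C] disappears on the way. In part (ii), almost sure
    convergence alone would not carry the change of measure to the limit; Y_m^r has to converge in
    L^1. The variables Q_i^alpha are Beta(i, 1), so the moments of Y_m are explicit and free of
    alpha: E Y_m^j is at most j!, and for m <= n the mean of Y_n Y_m depends on m only, as for a
    martingale. [V] and [Vr] are given by their laws only, so each assertion is established on the
    space of the jumps and then transported. *)

Section weighted_image.
Local Open Scope ereal_scope.
Context d d' (X : measurableType d) (Y : measurableType d') (R : realType).
Variables (mu : {measure set X -> \bar R}) (g : X -> R) (phi : X -> Y).
Hypotheses (mg : measurable_fun setT g) (g0 : forall x, (0 <= g x)%R).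
Hypothesis mphi : measurable_fun setT phi.

Let mindic A : measurable A -> measurable_fun setT (fun x => (\1_A (phi x) : R)%:E).
Proof.
move=> mA; apply/measurable_EFinP.
by apply: measurableT_comp => //; exact: measurable_indic.
Qed.

(* The proofs are parameters only so that the measure instance below can be
   inferred from the term. *)
Definition weighted_image (_ : measurable_fun setT g) (_ : forall x, (0 <= g x)%R)
    (_ : measurable_fun setT phi) (A : set Y) : \bar R :=
  \int[mu]_x ((g x)%:E * (\1_A (phi x))%:E).

Let nu := weighted_image mg g0 mphi.

Let nu0 : nu set0 = 0.
Proof.
by rewrite /nu /weighted_image integral0_eq// => x _; rewrite indic0 mule0.
Qed.

Let nu_ge0 A : 0 <= nu A.
Proof. by apply: integral_ge0 => x _; rewrite mule_ge0// lee_fin. Qed.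

Let nu_sigma_additive : semi_sigma_additive nu.
Proof.
move=> F mF tF mUF; rewrite /nu /weighted_image.
rewrite [X in _ --> X](_ : _ =
    \int[mu]_x (\sum_(n <oo) (g x)%:E * (\1_(F n) (phi x))%:E)).
  rewrite integral_nneseries//=.
  - apply: is_cvg_nneseries => n _ _.
    by apply: integral_ge0 => x _; rewrite mule_ge0// lee_fin.
  - by move=> n; apply: emeasurable_funM; first exact/measurable_EFinP; exact: mindic.
  - by move=> n x _; rewrite mule_ge0// lee_fin.
apply: eq_integral => x _; rewrite nneseriesZl; last first.
  by move=> n _; rewrite lee_fin.
congr (_ * _); rewrite (_ : (\1_(\bigcup_n F n) (phi x))%:E = \d_(phi x) (\bigcup_n F n))//.
by apply/esym/cvg_lim => //; exact: measure_semi_sigma_additive.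
Qed.

HB.instance Definition _ := isMeasure.Build _ _ _ (weighted_image mg g0 mphi)
  nu0 nu_ge0 nu_sigma_additive.

Import HBNNSimple.

(** Monotone approximation by simple functions. The measure [m] is arbitrary, subject to the formula
    on sets, so that the lemma serves image laws ([g = 1]), laws with a density ([phi = id]) and
    size-biased laws alike. *)
Lemma ge0_integral_weighted_image (m : {measure set Y -> \bar R}) (f : Y -> \bar R) :
  (forall A, measurable A -> m A = \int[mu]_x ((g x)%:E * (\1_A (phi x))%:E)) ->
  measurable_fun setT f -> (forall y, 0 <= f y) ->
  \int[m]_y f y = \int[mu]_x ((g x)%:E * f (phi x)).
Proof.
move=> mE mf f0; pose f_ := nnsfun_approx measurableT mf.
have mfphi n : measurable_fun setT (fun x => (g x)%:E * (f_ n (phi x))%:E).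
  apply: emeasurable_funM; first exact/measurable_EFinP; apply/measurable_EFinP.
  exact: measurableT_comp.
transitivity (limn (fun n => \int[m]_y (f_ n y)%:E)).
  rewrite -monotone_convergence//=.
  - apply: eq_integral => y _; apply/esym/cvg_lim => //.
    exact: cvg_nnsfun_approx.
  - by move=> n; exact/measurable_EFinP.
  - by move=> n y _; rewrite lee_fin.
  - by move=> y _ p n pn; rewrite lee_fin; exact/lefP/nd_nnsfun_approx.
transitivity (limn (fun n => \int[mu]_x ((g x)%:E * (f_ n (phi x))%:E))); last first.
  rewrite -monotone_convergence//=.
  - apply: eq_integral => x _; apply/cvg_lim => //.
    by apply: cvgeZl => //; exact: cvg_nnsfun_approx.
  - by move=> n x _; rewrite mule_ge0// lee_fin.
  - move=> x _ p n pn; rewrite lee_wpmul2l ?lee_fin//.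
    exact/lefP/nd_nnsfun_approx.
apply: congr_lim; apply/funext => n.
under eq_integral do rewrite fimfunE -fsumEFin//.
rewrite ge0_integral_fsum//; last 2 first.
  - by move=> y; exact/measurable_EFinP/measurable_funM.
  - by move=> y x _; rewrite nnfun_muleindic_ge0.
under [RHS]eq_integral => x _.
  rewrite fimfunE -fsumEFin// ge0_mule_fsumr; last first.
    by move=> r; rewrite EFinM nnfun_muleindic_ge0.
  over.
rewrite [RHS]ge0_integral_fsum//; last 2 first.
  - move=> r; apply: emeasurable_funM; first exact/measurable_EFinP; apply/measurable_EFinP.
    by apply: measurable_funM => //; apply: measurableT_comp => //; exact: measurable_indic.
  - move=> r x _; apply: mule_ge0; first by rewrite lee_fin. by rewrite EFinM nnfun_muleindic_ge0.
apply: eq_fsbigr => r _.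
rewrite integralZl_indic_nnsfun// integral_indic// setIT mE//.
(* A negative [r] is not a value of the approximant: its level set is empty and both sides vanish.
   For the other values the constant may leave the integral. *)
have [r0|r0] := ltP r 0%R.
  rewrite (_ : f_ n @^-1` [set r] = set0); last first.
    by apply/seteqP; split => // y /= fyr; move: r0; rewrite -fyr ltNge fun_ge0.
  under eq_integral do rewrite indic0 mule0.
  under [RHS]eq_integral do rewrite indic0 mulr0 mule0.
  by rewrite integral0 mule0.
rewrite -ge0_integralZl//.
- by apply: eq_integral => x _; rewrite EFinM muleCA.
- by apply: emeasurable_funM; first exact/measurable_EFinP; exact: mindic.
- by move=> x _; rewrite mule_ge0// lee_fin.
Qed.

End weighted_image.

(** * Finite measures determined by half-lines and by rectangles *)

Section uniqueness.
Context (R : realType).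

Lemma measurable_itvNyc_generated :
  measurable = <<s [set A | exists x : R, A = `]-oo, x]%classic] >>.
Proof.
set G := (X in <<s X >>).
have GNy b x : <<s G >> [set` Interval -oo%O (BSide b x)].
  case: b; last by apply: sub_sigma_algebra; exists x.
  have -> : [set` Interval -oo%O (BLeft x)] = \bigcup_k `]-oo, x - k.+1%:R^-1]%classic.
    apply/seteqP; split => y /=; rewrite ?in_itv/=.
      move=> yx; have xy0 : 0 < x - y by rewrite subr_gt0.
      have [k _ kxy] : \forall k \near \oo, k.+1%:R^-1 < x - y.
        exact: near_infty_natSinv_lt (PosNum xy0).
      exists k => //=; rewrite in_itv/= lerBrDr -lerBrDl ltW//.
      exact: kxy (leqnn k).
    move=> [k _] /=; rewrite in_itv/= => /le_lt_trans; apply.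
    by rewrite ltrBlDr ltrDl invr_gt0.
  apply: (@bigcupT_measurable _ (g_sigma_algebraType G)) => k.
  by apply: sub_sigma_algebra; eexists.
rewrite eqEsubset; split => A.
  apply: smallest_sub; first exact: smallest_sigma_algebra.
  move=> I [[a b] _ <-] /=.
  have -> : `]a, b]%classic = `]-oo, b] `\` `]-oo, a].
    apply/seteqP; split => x /=; rewrite !in_itv/=.
      by move=> /andP[ax xb]; split => //; apply/negP; rewrite -ltNge.
    by move=> [xb] /negP; rewrite -ltNge => ->.
  by apply: (@measurableD _ (g_sigma_algebraType G)); exact: GNy.
apply: smallest_sub; first exact: smallest_sigma_algebra.
by move=> _ [x ->]; exact: measurable_itv.
Qed.

Lemma finite_measure_unique_itvNyc (m1 m2 : {measure set R -> \bar R}) :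
  (m1 setT < +oo)%E ->
  (forall x : R, m1 `]-oo, x]%classic = m2 `]-oo, x]%classic) ->
  forall A, measurable A -> m1 A = m2 A.
Proof.
move=> m1oo m12 A mA.
apply: (measure_unique _ (fun n : nat => `]-oo, (n%:R : R)]%classic)
  measurable_itvNyc_generated) => //.
- move=> _ _ [x ->] [y ->]; exists (Num.min x y).
  by apply/seteqP; split => z /=; rewrite !in_itv/= le_min => /andP.
- by move=> n; exists n%:R.
- apply/seteqP; split => // x _; exists (Num.truncn `|x|).+1 => //=.
  by rewrite in_itv/= (le_trans (ler_norm _))// ltW// Num.Theory.truncnS_gt.
- by move=> _ [x ->].
- by move=> k; apply: le_lt_trans m1oo; apply: le_measure; rewrite ?inE.
Qed.

(** Coordinates from [n] on are free; these sets are a pi-system that generates the product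
    sigma-algebra. *)
Definition rectangle (n : nat) (B : nat -> set R) : set (seqs R) :=
  [set x | forall i, (i < n)%N -> B i (x i)].

Lemma measurable_rectangle n B : (forall i, measurable (B i)) ->
  measurable (rectangle n B).
Proof.
move=> mB; rewrite (_ : rectangle n B =
    \bigcap_(i in [set i | (i < n)%N]) ((fun x : seqs R => x i) @^-1` B i))//.
apply: bigcap_measurableType => i _; rewrite -[X in measurable X]setTI.
exact: (@measurable_seqs_coord R i).
Qed.

Lemma finite_measure_unique_rectangle (m1 m2 : {measure set (seqs R) -> \bar R}) :
  (m1 setT < +oo)%E ->
  (forall n B, (forall i, measurable (B i)) ->
    m1 (rectangle n B) = m2 (rectangle n B)) ->
  forall A, measurable A -> m1 A = m2 A.
Proof.
move=> m1oo m12 A mA.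
pose G := [set A | exists n, exists2 B, (forall i, measurable (B i)) &
  A = rectangle n B].
have mG : measurable = <<s G >>.
  rewrite eqEsubset; split; last first.
    apply: smallest_sub; first exact: smallest_sigma_algebra.
    by move=> _ [n [B mB ->]]; exact: measurable_rectangle.
  apply: smallest_sub; first exact: smallest_sigma_algebra.
  move=> _ [n _ [B mB <-]]; apply: sub_sigma_algebra; exists n.+1.
  exists (fun i => if i == n then B else setT).
    by move=> i; case: ifP.
  rewrite setTI; apply/seteqP; split => x /=.
    by move=> Bx i _; case: ifPn => // /eqP ->.
  by move=> /(_ n (ltnSn n)); rewrite eqxx.
apply: (measure_unique _ (fun=> setT) mG) => //.
(* Rectangles of different lengths are padded with [setT] before being intersected side by side. *)
- move=> _ _ [n [B mB ->]] [n' [B' mB' ->]]; exists (maxn n n').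
  exists (fun i => (if (i < n)%N then B i else setT) `&`
                   (if (i < n')%N then B' i else setT)).
    by move=> i; apply: measurableI; case: ifP.
  apply/seteqP; split => x /=.
    by move=> [Bx Bx'] i _; split; case: ifPn => // ?; [exact: Bx|exact: Bx'].
  move=> H; split=> i ii.
    by have := H i; rewrite leq_max ii/= => /(_ isT) -[].
  by have := H i; rewrite leq_max ii/= orbT => /(_ isT) -[].
- move=> _; exists 0%N; exists (fun=> setT) => //.
  by apply/seteqP; split.
- by rewrite bigcup_const.
- by move=> _ [n [B mB ->]]; exact: m12.
Qed.

End uniqueness.

Lemma independent_bigcap_ord d (T : measurableType d) (R : realType)
    (P : probability T R) d' (T' : measurableType d') (X : nat -> T -> T')
    (n : nat) (B : nat -> set T') :
  independent P X -> (forall i, measurable (B i)) ->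
  P (\bigcap_(i in `I_n) (X i @^-1` B i)) =
  (\prod_(i < n) P (X i @^-1` B i))%E.
Proof.
move=> iX mB; have := iX [fset i in iota 0 n]%fset B mB.
rewrite (_ : [set` _] = `I_n); last first.
  by apply/seteqP; split => i /=; rewrite !inE mem_iota add0n leq0n.
move=> ->; rewrite -(big_mkord xpredT (fun i => P (X i @^-1` B i))).
rewrite /index_iota subn0; apply: perm_big.
apply: uniq_perm; rewrite ?iota_uniq ?fset_uniq// => i.
by rewrite !inE.
Qed.

(** * From products of distribution functions to products of expectations *)

Section product_formula.
Local Open Scope ereal_scope.
Context d (T : measurableType d) (R : realType) (P : probability T R).
Variable X : nat -> {RV P >-> R}.

(** The form of independence that the law of the gaps delivers directly: initial segments of indices
    and half-lines. [expectation_prod] recovers the general product formula from it. *)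
Definition joint_cdf_prod := forall n (x : nat -> R),
  P (\bigcap_(i in `I_n) (X i @^-1` `]-oo, x i]%classic)) =
  \prod_(i < n) P (X i @^-1` `]-oo, x i]%classic).

Lemma independent_joint_cdf_prod : independent P X -> joint_cdf_prod.
Proof.
by move=> iX n x; exact: (independent_bigcap_ord n iX).
Qed.

Hypothesis jX : joint_cdf_prod.

(* Replace the indicators of half-lines by general functions one coordinate at a
   time: with the other factors frozen, two finite measures on the line agree. *)
Lemma expectation_prod n (F : nat -> R -> R) :
  (forall i, measurable_fun setT (F i)) ->
  (forall i y, (0 <= F i y <= 1)%R) ->
  \int[P]_w (\prod_(i < n) F i (X i w))%:E =
  \prod_(i < n) \int[P]_w (F i (X i w))%:E.
Proof.
move=> mF F01.
have mXi i (y : R) : measurable (X i @^-1` `]-oo, y]%classic).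
  by rewrite -[X in measurable X]setTI; exact: measurable_funP.
(* The induction is on the number [k] of leading coordinates with a general factor; the others carry
   half-line indicators, so [k = 0] is [jX]. Coordinates from [n] on do not occur in the products
   and may be reset to such an indicator. *)
suff : forall k (F : nat -> R -> R),
    (forall i, measurable_fun setT (F i)) ->
    (forall i y, (0 <= F i y <= 1)%R) ->
    (forall i, (k <= i)%N -> exists x : R, F i = \1_(`]-oo, x]%classic)) ->
    \int[P]_w (\prod_(i < n) F i (X i w))%:E =
    \prod_(i < n) \int[P]_w (F i (X i w))%:E.
  pose G i := if (i < n)%N then F i else \1_(`]-oo, 0%R]%classic).
  move=> /(_ n G).
  have E i : (i < n)%N -> G i = F i by rewrite /G => ->.
  rewrite (_ : \int[P]_w (\prod_(i < n) F i (X i w))%:E =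
    \int[P]_w (\prod_(i < n) G i (X i w))%:E); last first.
    by apply: eq_integral => w _; under [in RHS]eq_bigr do rewrite E//.
  under [in X in _ -> _ = X]eq_bigr do rewrite -E//.
  apply.
  - by move=> i; rewrite /G; case: ifPn => // _; exact: measurable_indic.
  - move=> i y; rewrite /G; case: ifPn => // _.
    by rewrite indicE; case: (_ \in _); rewrite /= ?lexx ?ler01.
  - by move=> i ni; exists 0%R; rewrite /G ltnNge ni.
move=> {mF F01 F}; elim => [|k IH] F mF F01 FE.
  have /choice[x xE] i : exists x : R, F i = \1_(`]-oo, x]%classic) by exact: FE.
  transitivity (\int[P]_w (\1_(\bigcap_(i in `I_n)
      (X i @^-1` `]-oo, x i]%classic)) w)%:E).
    apply: eq_integral => w _; congr (_%:E).
    have [wi|] := pselect (forall i, (i < n)%N -> (X i w <= x i)%R).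
      rewrite big1.
        by rewrite indicE mem_set// => i ni; rewrite /= in_itv/= wi.
      by move=> i _; rewrite xE indicE mem_set//= in_itv/= wi.
    move=> /existsNP[i /not_implyP[ni /negP xi]].
    rewrite (bigD1 (Ordinal ni))//= xE indicE memNset ?mul0r; last first.
      by rewrite /= in_itv/=; exact/negP.
    rewrite indicE memNset//= => /(_ i ni); rewrite /= in_itv/=; exact/negP.
  rewrite integral_indic//; last by apply: bigcap_measurableType => i _.
  rewrite setIT. rewrite [LHS](jX n x). apply: eq_bigr => i _.
  by rewrite xE -[X i @^-1` _]setIT -integral_indic.
have [nk|kn] := leqP n k.
  pose G i := if (i < n)%N then F i else \1_(`]-oo, 0%R]%classic).
  have E i : (i < n)%N -> G i = F i by rewrite /G => ->.
  under eq_integral do under eq_bigr => i _ do rewrite -E//.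
  under [in RHS]eq_bigr => i _ do rewrite -E//.
  apply: IH.
  - by move=> i; rewrite /G; case: ifPn => // _; exact: measurable_indic.
  - move=> i y; rewrite /G; case: ifPn => // _.
    by rewrite indicE; case: (_ \in _); rewrite /= ?lexx ?ler01.
  - by move=> i ki; exists 0%R; rewrite /G ltnNge (leq_trans nk ki).
pose h w := (\prod_(i < n | i != Ordinal kn) F i (X i w))%R.
have mF' i : measurable_fun setT (fun w => F i (X i w)).
  by apply: measurableT_comp => //; exact: mF.
have mh : measurable_fun setT h.
  under [X in measurable_fun _ X]eq_fun do rewrite big_mkcond/=.
  by apply: measurable_prod => i _; case: (i != _).
have h0 w : (0 <= h w)%R.
  by apply: prodr_ge0 => i _; case/andP: (F01 i (X i w)).
have h1 w : (h w <= 1)%R.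
  by apply: prodr_ile1 => i _.
pose c := \prod_(i < n | i != Ordinal kn) \int[P]_w (F i (X i w))%:E.
have Fint0 i : 0 <= \int[P]_w (F i (X i w))%:E.
  by apply: integral_ge0 => w _; rewrite lee_fin; case/andP: (F01 i (X i w)).
have c_fin : c \is a fin_num.
  rewrite /c; elim/big_ind : _ => // [x y|i _]; first exact: fin_numM.
  rewrite ge0_fin_numE//; apply: (@le_lt_trans _ _ (\int[P]_w 1%:E)).
    apply: ge0_le_integral => //.
    - by move=> w _; rewrite lee_fin; case/andP: (F01 i (X i w)).
    - exact/measurable_EFinP.
    - by move=> w _; rewrite lee_fin; case/andP: (F01 i (X i w)).
  by rewrite integral_cst// mul1e; exact: (le_lt_trans (probability_le1 _ _)) (ltry 1).
have c0 : 0 <= c by rewrite /c; elim/big_ind : _ => // x y; exact: mule_ge0.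
have mXk : measurable_fun setT (X k) by [].
(* [m1] weights the law of [X k] by the other factors, [m2] multiplies it by their mean. They agree
   on half-lines by the induction hypothesis, hence everywhere, and [F k] may be integrated against
   both. *)
pose m1 := weighted_image P mh h0 mXk.
pose m2 := mscale (NngNum (fine_ge0 c0)) (distribution P (X k)).
have m12 A : measurable A -> m2 A = m1 A.
  apply: finite_measure_unique_itvNyc; first by rewrite ltey_eq fin_num_measure.
  move=> x; apply/esym.
  pose G i := if i == k then \1_(`]-oo, x]%classic) else F i.
  have : \int[P]_w (\prod_(i < n) G i (X i w))%:E =
    \prod_(i < n) \int[P]_w (G i (X i w))%:E.
    apply: IH.
    - by move=> i; rewrite /G; case: ifPn => // _; exact: measurable_indic.
    - move=> i y; rewrite /G; case: ifPn => // _.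
      by rewrite indicE; case: (_ \in _); rewrite /= ?lexx ?ler01.
    - move=> i; rewrite leq_eqVlt => /predU1P[<-|/FE[y yE]].
        by exists x; rewrite /G eqxx.
      rewrite /G; case: eqP => _; [by exists x|by exists y].
  under eq_integral.
    move=> w _; rewrite (bigD1 (Ordinal kn))//= {1}/G eqxx.
    under eq_bigr.
      move=> i ik; rewrite /G ifF; last by apply/negbTE; move: ik; rewrite -val_eqE.
      over.
    rewrite -/(h w) EFinM muleC; over.
  rewrite (bigD1 (Ordinal kn))//=.
  under [in X in _ * X]eq_bigr.
    move=> i ik; rewrite /G ifF; last by apply/negbTE; move: ik; rewrite -val_eqE.
    over.
  rewrite -/c {1}/G eqxx.
  move=> E; rewrite [LHS]E /m2/= /mscale/= fineK// muleC; congr (_ * _).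
  by rewrite /distribution /pushforward -[X k @^-1` _]setIT -integral_indic//; exact: mXi.
have [mFk Fk01] := (mF k, F01 k).
have := @ge0_integral_weighted_image _ _ _ _ _ P h (X k) mh h0 mXk m2 (EFin \o F k) m12.
rewrite ge0_integral_mscale//=; last 2 first.
- exact/measurable_EFinP.
- by move=> y _; rewrite lee_fin; case/andP: (F01 k y).
rewrite ge0_integral_distribution//; last 2 first.
- exact/measurable_EFinP.
- by move=> y; rewrite lee_fin; case/andP: (F01 k y).
rewrite fineK// => E.
rewrite (bigD1 (Ordinal kn))//= -/c muleC E//; last 2 first.
- exact/measurable_EFinP.
- by move=> y; rewrite lee_fin; case/andP: (F01 k y).
apply: eq_integral => w _.
by rewrite (bigD1 (Ordinal kn))//= -/(h w) EFinM muleC.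
Qed.

End product_formula.

(** * Power densities *)

Section power_integrals.
Context (R : realType).
Local Notation mu := (@lebesgue_measure R).

(** The shape of the integrand covers the beta density ([c = 1], [p = a]) and the stable density
    ([c = - C], [p = - alpha]). *)
Lemma integral_powR_itvcc (c p a b : R) : 0 < a -> a < b ->
  (\int[mu]_(x in `[a, b]) (c * (p * x `^ (p - 1)))%:E =
   (c * b `^ p - c * a `^ p)%:E)%E.
Proof.
move=> a0 ab.
have dp q (x : R) : 0 < x -> derivable (@powR R ^~ q) x 1.
  by move=> x0; apply: derivable_powR; rewrite in_itv/= andbT.
have cp q (x : R) : 0 < x -> {for x, continuous (@powR R ^~ q)}.
  by move=> x0; apply: differentiable_continuous; apply/derivable1_diffP/dp.
rewrite (@continuous_FTC2 _ _ (fun x => c * x `^ p) a b)//.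
- apply: continuous_in_subspaceT => x; rewrite inE/= in_itv/= => /andP[ax _].
  apply: cvgM; first exact: cvg_cst.
  apply: cvgM; first exact: cvg_cst.
  by apply: cp; exact: lt_le_trans ax.
- have cF (x : R) : 0 < x -> {for x, continuous (fun x => c * x `^ p)}.
    by move=> x0; apply: cvgM; [exact: cvg_cst|exact: cp].
  split.
  + move=> x; rewrite in_itv/= => /andP[ax _].
    by apply: derivableM => //; apply: dp; exact: lt_trans ax.
  + by apply: cvg_at_right_filter; exact: cF.
  + by apply: cvg_at_left_filter; apply: cF; exact: lt_trans ab.
- move=> x; rewrite in_itv/= => /andP[ax _].
  have x0 : 0 < x by exact: lt_trans ax.
  have dpx := is_derive1_powR p x0.
  by rewrite derive1E derive_val.
Qed.

Lemma measurable_powR_density (c p : R) (D : set R) :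
  measurable_fun D (fun x : R => (c * (p * x `^ (p - 1)))%:E).
Proof.
apply/measurable_EFinP; apply: measurable_funM => //.
by apply: measurable_funM => //; exact: measurable_funTS.
Qed.

Lemma measurable_beta_density (a : R) (D : set R) :
  measurable_fun D (fun x : R => (a * x `^ (a - 1))%:E).
Proof.
by apply/measurable_EFinP; apply: measurable_funM => //; exact: measurable_funTS.
Qed.

Lemma cvg_powR0 (u : nat -> R) (a : R) : 0 < a -> (forall n, 0 < u n) ->
  u n @[n --> \oo] --> 0 -> u n `^ a @[n --> \oo] --> 0.
Proof.
move=> a0 u_gt0 u0; apply: (@cvg_comp _ _ _ u (@powR R ^~ a) _ 0^'+).
  move=> A A0; have := u0 _ A0; rewrite /nbhs/= /fmap/=; apply: filterS => n /=.
  by apply; exact: u_gt0.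
exact: powR_cvg0.
Qed.

Lemma integral_powR_itv0o (a u : R) : 0 < a -> 0 < u ->
  (\int[mu]_(x in `]0%R, u[) (a * x `^ (a - 1))%:E = (u `^ a)%:E)%E.
Proof.
move=> a0 u0.
(* The density may blow up at 0, so the interval is exhausted from the right; [n.+2] keeps the left
   endpoint strictly below [u]. *)
pose F n := `[u / n.+2%:R, u]%classic.
have un n : 0 < u / n.+2%:R by rewrite divr_gt0.
rewrite -(@integral_itv_bndoo R 0 u _ false false); last first.
  exact: measurable_beta_density.
have -> : `]0, u]%classic = \bigcup_n F n.
  apply/seteqP; split => x /=; rewrite ?in_itv/=.
    move=> /andP[x0 xu].
    have xu0 : 0 < x / u by rewrite divr_gt0.
    have [n _ nx] : \forall k \near \oo, k.+1%:R^-1 < x / u.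
      exact: near_infty_natSinv_lt (PosNum xu0).
    exists n => //; rewrite /F/= in_itv/= xu andbT.
    rewrite mulrC -ler_pdivlMr// ltW//.
    exact: nx (leqnSn n).
  move=> [n _]; rewrite /F/= in_itv/= => /andP[ux ->]; rewrite andbT.
  exact: lt_le_trans ux.
have := @ge0_nondecreasing_set_cvg_integral _ (measurableTypeR R) R F
  (fun x => (a * x `^ (a - 1))%:E) mu.
move=> /(_ _ _ _ _)/cvg_lim => <- //.
- apply/cvg_lim => //.
  rewrite (_ : (fun _ => _) = fun n => (u `^ a - (u / n.+2%:R) `^ a)%:E); last first.
    apply/funext => n.
    under eq_integral do rewrite -[a * _]mul1r.
    rewrite integral_powR_itvcc ?mul1r// ltr_pdivrMr// ltr_pMr//.
    by rewrite ltr1n.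
  apply: cvg_EFin; first by near=> n.
  rewrite -[X in _ --> X]subr0; apply: cvgB; first exact: cvg_cst.
  apply: cvg_powR0 => //; rewrite -[X in _ --> X](mulr0 u).
  apply: cvgM; first exact: cvg_cst.
  by rewrite (cvg_shiftS (@harmonic R)); exact: cvg_harmonic.
- move=> m n mn; apply/subsetPset => x; rewrite /F/= !in_itv/= => /andP[ux ->].
  rewrite andbT (le_trans _ ux)// ler_pM2l// lef_pV2 ?posrE//.
  by rewrite ler_nat !ltnS.
- by move=> n; exact: measurable_itv.
- by move=> n; exact: measurable_beta_density.
- by move=> n x _; rewrite lee_fin mulr_ge0 ?powR_ge0// ltW.
Unshelve. all: end_near. Qed.

Lemma integral_beta_itvNyc (a x : R) : 0 < a ->
  (\int[mu]_(y in `]-oo, x] `&` `]0%R, 1%R[) (a * y `^ (a - 1))%:E =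
   (Num.max 0 (Num.min x 1) `^ a)%:E)%E.
Proof.
move=> a0.
have [x0|x0] := leP x 0.
  rewrite (_ : _ `&` _ = set0) ?integral_set0; last first.
    apply/seteqP; split => // y /=; rewrite !in_itv/= => -[yx /andP[y0 _]].
    by have := lt_le_trans y0 (le_trans yx x0); rewrite ltxx.
  by rewrite max_l ?powR0 ?gt_eqF// ge_min x0.
rewrite max_r; last by rewrite le_min (ltW x0) ler01.
have [x1|x1] := leP 1 x.
  rewrite (_ : _ `&` _ = `]0, 1[%classic); first by rewrite integral_powR_itv0o.
  apply/seteqP; split => y /=; rewrite !in_itv/=; first by case.
  by move=> /andP[y0 y1]; rewrite y0 y1 (le_trans (ltW y1)).
rewrite -integral_powR_itv0o// (_ : _ `&` _ = `]0, x]%classic).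
  rewrite (@integral_itv_bndoo R 0 x _ false false)//.
  exact: measurable_beta_density.
apply/seteqP; split => y /=; rewrite !in_itv/=.
  by move=> [-> /andP[-> _]].
by move=> /andP[-> yx]; rewrite yx (le_lt_trans yx).
Qed.

Variables (C alpha : R) (C0 : 0 < C) (alpha0 : 0 < alpha).

Let densityE x : stable_density C alpha x = - C * (- alpha * x `^ (- alpha - 1)).
Proof. by rewrite /stable_density mulrA mulrNN. Qed.

Lemma stable_intensity_itvco (a b : R) : 0 < a -> a <= b ->
  stable_intensity C alpha `[a, b[ = (C * a `^ (- alpha) - C * b `^ (- alpha))%:E.
Proof.
move=> a0; rewrite le_eqVlt => /predU1P[<-|ab].
  by rewrite /stable_intensity set_itvco0 integral_set0 subrr.
rewrite /stable_intensity; under eq_integral do rewrite densityE.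
rewrite integral_itv_bndo_bndc; last exact: measurable_powR_density.
by rewrite integral_powR_itvcc// !mulNr opprK addrC.
Qed.

Lemma stable_intensity_itvcy (a : R) : 0 < a ->
  stable_intensity C alpha `[a, +oo[ = (C * a `^ (- alpha))%:E.
Proof.
move=> a0; rewrite /stable_intensity.
pose F n := `[a, a + n%:R[%classic.
have -> : `[a, +oo[%classic = \bigcup_n F n.
  apply/seteqP; split => x /=; rewrite ?in_itv/= ?andbT.
    move=> ax; exists (Num.truncn (x - a)).+1 => //; rewrite /F/= in_itv/= ax/=.
    by rewrite -ltrBlDl Num.Theory.truncnS_gt.
  by move=> [n _]; rewrite /F/= in_itv/= => /andP[].
have := @ge0_nondecreasing_set_cvg_integral _ (measurableTypeR R) R F
  (fun x => (stable_density C alpha x)%:E) mu.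
move=> /(_ _ _ _ _)/cvg_lim => <- //.
- apply/cvg_lim => //.
  rewrite (_ : (fun _ => _) =
      fun n => (C * a `^ (- alpha) - C * (a + n%:R) `^ (- alpha))%:E); last first.
    apply/funext => n; apply: stable_intensity_itvco => //.
    by rewrite lerDl.
  apply: cvg_EFin; first by near=> n.
  rewrite -[X in _ --> X]subr0; apply: cvgB; first exact: cvg_cst.
  rewrite -[X in _ --> X](mulr0 C); apply: cvgM; first exact: cvg_cst.
  rewrite (_ : (fun _ => _) = fun n => (a + n%:R)^-1 `^ alpha); last first.
    apply/funext => n; have an0 : 0 <= a + n%:R by rewrite addr_ge0// ltW.
    by rewrite -powR_inv1// -powRrM mulN1r.
  apply: cvg_powR0 => //; first by move=> n; rewrite invr_gt0 ltr_wpDr.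
  apply/gtr0_cvgV0; first by near=> n; rewrite ltr_wpDr.
  have : (n%:R : R) @[n --> \oo] --> +oo by exact: cvgr_idn.
  by apply: ger_cvgy; near=> n; rewrite lerDr ltW.
- move=> m n mn; apply/subsetPset => x; rewrite /F/= !in_itv/= => /andP[-> /=].
  by move=> /lt_le_trans; apply; rewrite lerD2l ler_nat.
- by move=> n; exact: measurable_itv.
- move=> n; rewrite (_ : (fun _ => _) = fun x : R =>
    (- C * (- alpha * x `^ (- alpha - 1)))%:E); last first.
    by apply/funext => x; rewrite densityE.
  exact: measurable_powR_density.
- move=> n x _; rewrite lee_fin /stable_density mulr_ge0 ?powR_ge0//.
  by rewrite mulr_ge0// ltW.
Unshelve. all: end_near. Qed.

End power_integrals.

(** * Cell probabilities of the ranked Poisson points *)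

Lemma ae_eq_measure d (T : measurableType d) (R : realType)
    (mu : {measure set T -> \bar R}) (A B : set T) :
  measurable A -> measurable B -> {ae mu, forall w, A w <-> B w} -> mu A = mu B.
Proof.
move=> mA mB AB; rewrite -[A]setIT -[B]setIT -!integral_indic//.
apply: ge0_ae_eq_integral => //.
- by apply/measurable_EFinP; exact: measurable_indic.
- by apply/measurable_EFinP; exact: measurable_indic.
case: AB => N [mN N0 HN]; exists N; split => //; apply: subset_trans HN.
apply: subsetC => w /= AB _; rewrite !indicE; congr (_%:R%:E).
by congr nat_of_bool; apply/idP/idP; rewrite !inE => /AB.
Qed.

Section counting.
Local Open Scope ereal_scope.
Context (R : realType) (x : nat -> R).

Let cnt (A : set R) : \bar R := \sum_(n <oo) \d_(x n) A.

Let cntD1 A i : cnt A = (\1_A (x i))%:E + \sum_(n <oo | n != i) \d_(x n) A.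
Proof. by rewrite /cnt (@nneseriesD1 _ _ i). Qed.

Lemma count_eq0 A : (cnt A = 0) <-> forall n, ~ A (x n).
Proof.
split => [c0 n An|An]; last first.
  by apply: eseries0 => n _ _; rewrite diracE memNset.
suff : 1 <= cnt A by rewrite c0 lee_fin ler10.
rewrite (cntD1 _ n) indicE mem_set// leeDl//.
exact: nneseries_ge0.
Qed.

Lemma count_eq1 A i : A (x i) -> (cnt A = 1) <-> forall n, A (x n) -> n = i.
Proof.
move=> Ai; rewrite (cntD1 _ i) indicE mem_set//.
split => [c1 n An|Ai1]; last first.
  rewrite eseries0 ?adde0// => n _ ni; rewrite diracE memNset// => /Ai1 /eqP.
  by rewrite (negbTE ni).
apply/eqP/negP => ni.
suff : (1 + 1 : \bar R) <= 1 by rewrite -EFinD lee_fin -subr_ge0 opprD addNKr oppr_ge0 ler10.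
rewrite -[leRHS]c1 leeD2l//.
rewrite (@nneseriesD1 _ _ n)//; last exact/negP.
rewrite diracE mem_set// leeDl// nneseries_ge0//.
Qed.

Hypothesis (x_decr : forall n, (x n.+1 < x n)%R).
Variable s : nat -> R.
Hypothesis s_decr : {homo s : i j / (i <= j)%N >-> (j <= i)%R}.

(** Numbered downwards from infinity, as ranks are. In what follows odd indices are the cells meant
    to hold one point each, and even indices are the gaps just above them. *)
Definition interval_chain (j : nat) : set R :=
  if j is j'.+1 then `[s j, s j'[%classic else `[s 0%N, +oo[%classic.

Lemma trivIset_interval_chain : trivIset setT interval_chain.
Proof.
apply/trivIsetP => i j _ _; wlog ij : i j / (i < j)%N.
  move=> H; rewrite neq_lt => /orP[ij|ji]; first by apply: H => //; rewrite lt_eqF.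
  by rewrite setIC; apply: H => //; rewrite lt_eqF.
move=> _; apply/seteqP; split => // y [].
case: j ij => // j ij /= yi; rewrite in_itv/= => /andP[_ yj].
have : (s i <= y)%R.
  by case: i yi {ij} => [|i] /=; rewrite in_itv/= => /andP[].
by move=> siy; have := lt_le_trans yj (@s_decr i j ij); rewrite ltNge siy.
Qed.

Let chain_ge j y : interval_chain j y -> (s j <= y)%R.
Proof. by case: j => [|j] /=; rewrite in_itv/= => /andP[]. Qed.

Let x_lt i j : (i < j)%N -> (x j < x i)%R.
Proof.
elim: j => // j IH; rewrite ltnS leq_eqVlt => /predU1P[->//|/IH].
exact: lt_trans.
Qed.

Let chain_inj i j y : interval_chain i y -> interval_chain j y -> i = j.
Proof.
move=> Ai Aj; apply/eqP/negP => /negP ij.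
have /trivIsetP/(_ i j I I ij) := trivIset_interval_chain.
by move=> /seteqP[+ _] => /(_ y); apply.
Qed.

(** Nothing is prescribed below [x m], and the last cell may contain further points: this is why its
    count is only required to be nonzero, whereas the earlier cells hold exactly one point. *)
Lemma count_interval_chain m :
  (forall i, (i <= m)%N -> interval_chain i.*2.+1 (x i)) <->
  [/\ forall i, (i <= m)%N -> cnt (interval_chain i.*2) = 0,
      forall i, (i < m)%N -> cnt (interval_chain i.*2.+1) = 1
    & cnt (interval_chain m.*2.+1) <> 0].
Proof.
split=> [H|[H0 H1 Hm]].
  have xm n : (m < n)%N -> (x n < s m.*2)%R.
    move=> mn; have /= := H m (leqnn m); rewrite in_itv/= => /andP[_].
    by apply: lt_trans; exact: x_lt.
  have key n i : (i <= m.*2)%N -> interval_chain i (x n) -> i = n.*2.+1.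
    move=> im Ai; have [nm|mn] := leqP n m.
      by apply: (chain_inj Ai); exact: H.
    have := lt_le_trans (xm _ mn) (le_trans (s_decr im) (chain_ge Ai)).
    by rewrite ltxx.
  split=> [i im|i im|].
  - apply/count_eq0 => n /key; rewrite leq_double => /(_ im)/(congr1 odd).
    by rewrite /= !odd_double.
  - apply/(@count_eq1 _ i); first exact/H/ltnW.
    move=> n /key; rewrite ltn_double => /(_ im)[].
    by move=> /(congr1 half); rewrite !doubleK.
  - by move/count_eq0/(_ m); apply; exact: H.
move=> i; elim/ltn_ind: i => i IH im.
have [n An] : exists n, interval_chain i.*2.+1 (x n).
  apply: contrapT => /forallNP c0.
  move: im; rewrite leq_eqVlt => /predU1P[im|im].
    by apply: Hm; rewrite -im; exact/count_eq0.
  have := H1 i im; move/count_eq0 : c0 => ->.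
  by move=> /eqP; rewrite eq_sym onee_eq0.
(* A point of rank below [i] lies in its own cell by induction, so the point found in cell [i] has
   rank at least [i], and [x i] is not below the cell. *)
have xin : (x n <= x i)%R.
  have [ni|ni|->//] := ltngtP n i; last by exact/ltW/x_lt.
  have := IH n ni (ltnW (leq_trans ni im)) => /(chain_inj An)[].
  by move=> /(congr1 half); rewrite !doubleK => ni'; move: ni; rewrite ni' ltnn.
have sxi : (s i.*2.+1 <= x i)%R by exact: le_trans (chain_ge An) xin.
(* Were [x i] above its cell, it would fall in the empty gap over it or share the preceding cell
   with the point of the preceding rank. *)
rewrite /= in_itv/= sxi/= ltNge; apply/negP => sxi2.
case: i => [|i] in IH im n An xin sxi sxi2 *.
  have /count_eq0/(_ 0%N) := H0 0%N im; apply.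
  by rewrite /= in_itv/= sxi2.
have := IH i (ltnSn i) (ltnW im) => Ai.
have xSi : (x i.+1 < s i.*2)%R.
  by move: Ai => /=; rewrite in_itv/= => /andP[_]; exact/lt_trans.
have [xs|sx] := ltP (x i.+1) (s i.*2.+1).
  have /count_eq0/(_ i.+1) := H0 i.+1 im; apply.
  by rewrite /= in_itv/= sxi2.
have /(count_eq1 Ai)/(_ i.+1) := H1 i im.
rewrite /= in_itv/= sx xSi => /(_ isT)/eqP.
by rewrite eqn_leq ltnn.
Qed.

End counting.

Section stable_chain.
Context d (T : measurableType d) (R : realType) (P : probability T R).
Variables (C alpha : R) (C_gt0 : 0 < C) (alpha_gt0 : 0 < alpha).
Variables (Delta : nat -> {RV P >-> R}) (jumps : stable_jumps P C alpha Delta).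

Lemma jumps_decreasing : {ae P, forall w, forall n, 0 < Delta n.+1 w < Delta n w}.
Proof. by case: jumps. Qed.

Lemma poisson_count (A : set R) (l : R) (k : nat) :
  measurable A -> A `<=` `]0, +oo[ -> stable_intensity C alpha A = l%:E -> 0 <= l ->
  P [set w | point_count Delta A w = k%:R%:E] =
  (l ^+ k / k`!%:R * expR (- l))%:E.
Proof.
move=> mA A0 Al; rewrite le_eqVlt => l0.
case: jumps => _ /(_ A mA A0) + _; rewrite /poisson_law Al => -> .
(* Mean 0 does occur, for the empty gap between two adjacent cells; the law is then the point mass
   at 0. *)
rewrite /poisson_prob; case/predU1P : l0 => [<-|l0].
  rewrite ltxx diracE oppr0 expR0 mulr1.
  case: k => [|k]; first by rewrite mem_set// expr0 fact0 divr1.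
  by rewrite memNset// expr0n mul0r.
rewrite l0 esum_set1 ?lee_fin ?poisson_pmf_ge0//.
by rewrite /poisson_pmf l0.
Qed.

Lemma measurable_point_count (A : set R) : measurable A ->
  measurable_fun setT (point_count Delta A).
Proof.
move=> mA; rewrite /point_count.
apply: (@ge0_emeasurable_sum _ _ _ _ (fun n w => \d_(Delta n w) A) xpredT) => // n _.
exact: (measurableT_comp (measurable_fun_dirac mA)).
Qed.

Variable s : nat -> R.
Hypothesis s_gt0 : forall i, 0 < s i.
Hypothesis s_decr : {homo s : i j / (i <= j)%N >-> j <= i}.

Let g i := C * s i `^ (- alpha).
Let g' i := if i is i'.+1 then g i' else 0.

Let g_incr i : g' i <= g i.
Proof.
case: i => [|i]; first by rewrite /= /g mulr_ge0 ?powR_ge0// ltW.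
rewrite /= /g ler_pM2l// !powRN lef_pV2 ?posrE ?powR_gt0//.
by apply: ge0_ler_powR; rewrite ?nnegrE ?(ltW alpha_gt0) ?(ltW (s_gt0 _))//; exact: s_decr.
Qed.

Lemma measurable_interval_chain j : measurable (interval_chain s j).
Proof. by case: j => [|j]; exact: measurable_itv. Qed.

Let chain_pos j : interval_chain s j `<=` `]0, +oo[.
Proof.
by case: j => [|j] x /=; rewrite !in_itv/= ?andbT => H; [|case/andP: H => H _];
  exact: lt_le_trans H.
Qed.

Let chain_intensity j :
  stable_intensity C alpha (interval_chain s j) = (g j - g' j)%:E.
Proof.
case: j => [|j] /=; first by rewrite stable_intensity_itvcy// subr0.
by rewrite stable_intensity_itvco//; exact: s_decr.
Qed.

Let N j := point_count Delta (interval_chain s j).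

Let p_chain j k : P [set w | N j w = k%:R%:E] =
  ((g j - g' j) ^+ k / k`!%:R * expR (- (g j - g' j)))%:E.
Proof.
apply: poisson_count => //; first exact: measurable_interval_chain.
by rewrite subr_ge0.
Qed.

(** [g i] is the mean number of points above [s i]. Each void or one-point interval contributes
    exp(- mean), and these factors telescope to [expR (- g m.*2)]; the one-point cells also
    contribute their means, the last cell one minus its void probability. *)
Lemma interval_chain_prob m :
  P (\bigcap_(i in `I_m.+1) (Delta i @^-1` interval_chain s i.*2.+1)) =
  ((\prod_(i < m) (g i.*2.+1 - g i.*2)) *
   (expR (- g m.*2) * (1 - expR (- (g m.*2.+1 - g m.*2)))))%:E.
Proof.
pose B j : set (\bar R) := if odd j then (if (j < m.*2)%N then [set 1%E] else ~` [set 0%E])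
  else [set 0%E].
have mB j : measurable (B j).
  rewrite /B; case: ifP => _; last exact: emeasurable_set1.
  case: ifP => _; first exact: emeasurable_set1.
  by apply: measurableC; exact: emeasurable_set1.
have mN j : measurable_fun setT (N j).
  by apply: measurable_point_count; exact: measurable_interval_chain.
have indep : independent P N.
  case: jumps => _ _; apply => //; first exact: measurable_interval_chain.
  exact: trivIset_interval_chain.
transitivity (P (\bigcap_(j in `I_m.*2.+2) (N j @^-1` B j))).
  apply: ae_eq_measure.
  - apply: bigcap_measurableType => i _; rewrite -[X in measurable X]setTI.
    by apply: measurable_funP => //; exact: measurable_interval_chain.
  - apply: bigcap_measurableType => i _; rewrite -[X in measurable X]setTI.
    exact: mN.
  case: jumps_decreasing => Z [mZ Z0 HZ]; exists Z; split => //.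
  apply: subset_trans HZ; apply: subsetC => w /= Hw.
  have decr n : Delta n.+1 w < Delta n w by case/andP: (Hw n).
  have := @count_interval_chain R (Delta ^~ w) decr s s_decr m.
  set L := (X in X <-> _); set Rh := (X in _ <-> X); move=> LR.
  split => [H|H].
    have [|H0 H1 Hm] := LR.1 _; first by move=> i im; exact: H.
    move=> j /= jm; rewrite /preimage /B/=; case: ifPn => oj; last first.
      have jE : j = j./2.*2 by lia.
      by rewrite /= jE; apply: H0; lia.
    case: ifPn => jm2.
      have jE : j = j./2.*2.+1 by lia.
      by rewrite /= jE; apply: H1; lia.
    by have -> : j = m.*2.+1 by lia.
  move=> i /= im; apply: (LR.2 _ i im); split.
  - move=> {}i {}im; have := H i.*2; rewrite /preimage /B/= odd_double/=; apply.
    by rewrite /= ltnS; lia.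
  - move=> {}i {}im; have := H i.*2.+1; rewrite /preimage /B/= odd_double/=.
    by rewrite ltn_Sdouble im; apply; lia.
  - have := H m.*2.+1; rewrite /preimage /B/= odd_double/=.
    by rewrite (_ : (m.*2.+1 < m.*2)%N = false); [apply|lia].
rewrite (independent_bigcap_ord _ indep)//.
have pB0 i : P (N i.*2 @^-1` B i.*2) = (expR (- (g i.*2 - g' i.*2)))%:E.
  by have := p_chain i.*2 0; rewrite expr0 fact0 divr1 mul1r /preimage /B odd_double.
have pB1 i : (i < m)%N -> P (N i.*2.+1 @^-1` B i.*2.+1) =
    ((g i.*2.+1 - g i.*2) * expR (- (g i.*2.+1 - g i.*2)))%:E.
  move=> im; have := p_chain i.*2.+1 1; rewrite expr1 divr1.
  by rewrite /preimage /B /= odd_double/= ltn_Sdouble im.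
have pBm : P (N m.*2.+1 @^-1` B m.*2.+1) = (1 - expR (- (g m.*2.+1 - g m.*2)))%:E.
  rewrite /B/= odd_double/= (_ : (m.*2.+1 < m.*2)%N = false); last lia.
  rewrite -preimage_setC probability_setC; last first.
    by rewrite -[X in measurable X]setTI; apply: mN => //; exact: emeasurable_set1.
  by have := p_chain m.*2.+1 0; rewrite expr0 fact0 divr1 mul1r => ->.
suff H n : (n <= m)%N -> (\prod_(j < n.*2) P (N j @^-1` B j) =
    ((\prod_(i < n) (g i.*2.+1 - g i.*2)) * expR (- g' n.*2))%:E)%E.
  rewrite big_ord_recr big_ord_recr/= H// pB0 pBm -!EFinM; congr (_%:E).
  by rewrite -!mulrA; congr (_ * _); rewrite mulrA -expRD; congr (expR _ * _); ring.
elim: n => [|n IH] nm; first by rewrite !big_ord0 /= oppr0 expR0 mul1r.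
rewrite doubleS big_ord_recr big_ord_recr/= IH ?(ltnW nm)// pB0 pB1//.
rewrite big_ord_recr/= -!EFinM; congr (_%:E); rewrite -!mulrA; congr (_ * _).
have -> : expR (- g n.*2.+1) = expR (- g' n.*2) *
    (expR (- (g n.*2 - g' n.*2)) * expR (- (g n.*2.+1 - g n.*2))).
  by rewrite -!expRD; congr expR; ring.
ring.
Qed.

End stable_chain.

(** * Geometric discretization of the jumps *)

Lemma measurable_floor (R : realType) :
  measurable_fun setT (fun x : R => (Num.floor x)%:~R : R).
Proof.
apply: (@measurability _ _ _ _ setT _ (@RGenCInfty.G R)).
  exact: RGenCInfty.measurableE.
move=> _ [_ [y ->] <-]; rewrite setTI.
rewrite (_ : _ @^-1` _ = `[(Num.ceil y)%:~R, +oo[%classic) //.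
apply/seteqP; split => x /=; rewrite !in_itv/= !andbT.
  by rewrite -floor_ge_int -ceil_le_int.
by rewrite -ceil_le_int floor_ge_int.
Qed.

Lemma measurable_le_set d (T : measurableType d) (R : realType) (f g : T -> R) :
  measurable_fun setT f -> measurable_fun setT g ->
  measurable [set w | f w <= g w].
Proof.
move=> mf mg.
rewrite (_ : [set w | _] = (fun w => g w - f w) @^-1` `[0, +oo[%classic).
  rewrite -[X in measurable X]setTI.
  by apply: measurable_funB => //; exact: measurable_itv.
by apply/seteqP; split => w /=; rewrite in_itv/= andbT subr_ge0.
Qed.

Lemma nneseries_geometric (R : realType) (a z : R) : 0 <= z < 1 ->
  (\sum_(n <oo) (a * z ^+ n)%:E = (a / (1 - z))%:E)%E.
Proof.
move=> /andP[z0 z1]; apply/cvg_lim => //.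
rewrite (_ : (fun _ => _) = EFin \o series (geometric a z)); last first.
  by apply/funext => n; rewrite /= sumEFin.
apply: cvg_EFin; first exact: nearW.
by apply: cvg_geometric_series; rewrite ger0_norm.
Qed.

Section discretization.
Context d (T : measurableType d) (R : realType) (P : probability T R).
Variables (C alpha : R) (C_gt0 : 0 < C) (alpha_gt0 : 0 < alpha).
Variables (Delta : nat -> {RV P >-> R}) (jumps : stable_jumps P C alpha Delta).
Variables (h : R) (h_gt0 : 0 < h).

Definition log_cell (i : nat) (w : T) : int := Num.floor (ln (Delta i w) / h).

Local Notation K := log_cell.

Let qe (k : int) : R := expR (- (alpha * h) * k%:~R).

Let qeD k l : qe (k + l) = qe k * qe l.
Proof. by rewrite /qe intrD mulrDr expRD. Qed.

Let qe_gt0 k : 0 < qe k. Proof. exact: expR_gt0. Qed.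

Let qe1_lt1 : qe 1 < 1.
Proof. by rewrite -[ltRHS]expR0 ltr_expR mulr1 oppr_lt0 mulr_gt0. Qed.

(** [c * qe k] is the mean number of points in cell [k], and [E k] below is the probability that the
    largest point falls there: none above the cell, at least one in it. *)
Let c := C * (1 - qe 1).

Let E (k : int) := expR (- (C * qe (k + 1))) * (1 - expR (- (c * qe k))).

Lemma measurable_ln_jump i : measurable_fun setT (fun w => ln (Delta i w)).
Proof. by apply: measurableT_comp => //; exact: measurable_ln. Qed.

Let mK i : measurable_fun setT (fun w => (K i w)%:~R : R).
Proof.
apply: (measurableT_comp (@measurable_floor R)).
by apply: measurable_funM => //; exact: measurable_ln_jump.
Qed.

Lemma measurable_cell_eq i k : measurable [set w | K i w = k].
Proof.
rewrite (_ : [set w | _] = (fun w => (K i w)%:~R : R) @^-1` [set k%:~R]).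
  by rewrite -[X in measurable X]setTI; exact: mK.
apply/seteqP; split => w /=; first by move=> ->.
by move=> /eqP; rewrite eqr_int => /eqP.
Qed.

Lemma measurable_cell_gap i (k : nat) :
  measurable [set w | K i.+1 w + k%:Z <= K i w].
Proof.
rewrite (_ : [set w | _] =
    [set w | (K i.+1 w)%:~R + k%:R <= (K i w)%:~R :> R]).
  by apply: measurable_le_set => //; exact: measurable_funD.
by apply/funext => w /=; rewrite -(ler_int R) intrD.
Qed.

Lemma cell_chain_prob m (k : nat -> int) : (forall i, k i.+1 < k i) ->
  P (\bigcap_(i in `I_m.+1) [set w | K i w = k i]) =
  ((\prod_(i < m) (c * qe (k i))) * E (k m))%:E.
Proof.
move=> k_decr.
(* Even indices give the upper ends of the cells, odd ones the lower ends. *)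
pose s j := expR (h * (k j./2 + ~~ odd j)%:~R).
have s0 i : s i.*2 = expR (h * (k i + 1)%:~R).
  by rewrite /s doubleK odd_double.
have s1 i : s i.*2.+1 = expR (h * (k i)%:~R).
  by rewrite /s /= uphalf_double odd_double/= addr0.
have s_decr : {homo s : i j / (i <= j)%N >-> j <= i}.
  apply/nonincreasing_seqP => j; rewrite -(odd_double_half j).
  case: (odd j) => /=; rewrite ?add1n ?add0n.
    by rewrite -doubleS s0 s1 ler_expR ler_pM2l// ler_int; have := k_decr j./2; lia.
  by rewrite s0 s1 ler_expR ler_pM2l// ler_int; lia.
have s_gt0 j : 0 < s j by exact: expR_gt0.
transitivity (P (\bigcap_(i in `I_m.+1) (Delta i @^-1` interval_chain s i.*2.+1))).
  apply: ae_eq_measure.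
  - by apply: bigcap_measurableType => i _; exact: measurable_cell_eq.
  - apply: bigcap_measurableType => i _; rewrite -[X in measurable X]setTI.
    by apply: measurable_funP => //; exact: measurable_interval_chain.
  case: (jumps_decreasing jumps) => Z [mZ Z0 HZ]; exists Z; split => //.
  apply: subset_trans HZ; apply: subsetC => w /= Hw.
  have D0 i : 0 < Delta i w by case/andP: (Hw i) => /lt_trans; apply.
  have Ki i : (K i w = k i) <-> (interval_chain s i.*2.+1) (Delta i w).
    rewrite /= in_itv/= s1 s0 -[Delta i w]lnK ?posrE// ler_expR ltr_expR.
    rewrite /K -!ler_pdivlMl// -!ltr_pdivrMl// !(mulrC h^-1).
    by rewrite -floor_eq; split => [->|/eqP].
  by split => H i im; apply/Ki/H.
rewrite (interval_chain_prob C_gt0 alpha_gt0 jumps)//.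
have sa x : expR (h * x%:~R) `^ (- alpha) = qe x.
  by rewrite -expRM /qe; congr expR; ring.
congr (_%:E); congr (_ * _).
  apply: eq_bigr => i _; rewrite s0 s1 !sa qeD /c; ring.
rewrite /E s0 s1 !sa; congr (_ * (1 - expR _)); rewrite qeD /c; ring.
Qed.

(* Induction on n: summing over the value of the n-th cell index is a geometric
   series, because the cells have C (1 - q) q^k as mean number of points. *)
Lemma cell_gap_prob n (j : nat -> nat) (jn : forall i, (0 < j i)%N) m (k : nat -> int) :
  (n <= m)%N -> (forall i, k i.+1 < k i) ->
  P (\bigcap_(i in `I_n) [set w | K i.+1 w + (j i)%:Z <= K i w] `&`
     \bigcap_(i in [set i | (n <= i <= m)%N]) [set w | K i w = k i]) =
  ((\prod_(i < n) (c * qe (j i)%:Z ^+ i.+1 / (1 - qe 1 ^+ i.+1))) *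
   qe (k n) ^+ n * (\prod_(n <= i < m) (c * qe (k i))) * E (k m))%:E.
Proof.
elim: n k => [|n IH] k nm k_decr.
  rewrite (_ : _ `&` _ = \bigcap_(i in `I_m.+1) [set w | K i w = k i]).
    by rewrite cell_chain_prob// big_ord0 expr0 !mul1r big_mkord.
  apply/seteqP; split => w /=.
    by move=> [_ H] i im; exact: H.
  by move=> H; split => // i /= im; exact: H.
(* [t] is the excess of the [n]-th gap over its lower bound, so [l t] runs through the admissible
   values of [K n]. Below [n] the sequence [k'] is an arbitrary strictly decreasing continuation. *)
pose l t : int := k n.+1 + (j n)%:Z + t%:Z.
pose k' t i : int := if (i <= n)%N then l t + (n - i)%N%:Z else k i.
have k'_decr t i : k' t i.+1 < k' t i.
  rewrite /k'; case: ifPn => ni; first by rewrite (ltnW ni); lia.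
  have -> // : (i <= n)%N = (i == n) by lia.
  case: eqP => [->|//]; rewrite /l subnn; have := jn n; lia.
pose F t := \bigcap_(i in `I_n) [set w | K i.+1 w + (j i)%:Z <= K i w] `&`
     \bigcap_(i in [set i | (n <= i <= m)%N]) [set w | K i w = k' t i].
have mF t : measurable (F t).
  apply: measurableI; apply: bigcap_measurableType => i _.
    exact: measurable_cell_gap.
  exact: measurable_cell_eq.
rewrite (_ : _ `&` _ = \bigcup_t F t); last first.
  apply/seteqP; split => w /=.
    move=> [H1 H2].
    have H3 := H1 n (ltnSn n); rewrite /= in H3.
    have Kn1 : K n.+1 w = k n.+1 by apply: H2; rewrite /= leqnn.
    rewrite Kn1 in H3.
    have [t tE] : exists t : nat, K n w = l t.
      by exists (absz (K n w - (k n.+1 + (j n)%:Z))%R); rewrite /l; lia.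
    exists t => //; split.
      by move=> i /= ni; apply: H1; rewrite /= (ltn_trans ni).
    move=> i /= /andP[]; rewrite leq_eqVlt => /predU1P[<- _|ni im].
      by rewrite /k' leqnn subnn addr0.
    by rewrite /k' leqNgt ni/=; apply: H2; rewrite /= ni.
  move=> [t _ [H1 H2]]; split.
    move=> i /=; rewrite ltnS leq_eqVlt => /predU1P[->|]; last exact: H1.
    have /= -> := H2 n.+1; last by rewrite /= leqnSn.
    have /= -> := H2 n; last by rewrite /= leqnn ltnW.
    by rewrite /k' leqnn ltnn subnn /l; lia.
  move=> i /= /andP[ni im]; have /= -> := H2 i; last by rewrite /= (ltnW ni).
  by rewrite /k' leqNgt ni.
rewrite measure_bigcup//; last first.
  apply/trivIsetP => t u _ _ tu; apply/seteqP; split => // w [[_ H] [_ H']].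
  have := H n; rewrite /= leqnn (ltnW nm) => /(_ isT).
  have /= -> := H' n; last by rewrite /= leqnn ltnW.
  by rewrite /k' leqnn subnn /l => /addIr /addrI [] tu'; rewrite tu' eqxx in tu.
pose G := \prod_(i < n) (c * qe (j i)%:Z ^+ i.+1 / (1 - qe 1 ^+ i.+1)) *
  c * (qe (k n.+1) * qe (j n)%:Z) ^+ n.+1 *
  (\prod_(n.+1 <= i < m) (c * qe (k i))) * E (k m).
have qet (t : nat) : qe t%:Z = qe 1 ^+ t.
  have tE : (t%:Z)%:~R = t%:R :> R by [].
  by rewrite /qe tE -expRM_natl mulr1 mulrC.
(* The weight [qe (k n) ^+ n] left by the earlier sums joins the mean of cell [k n], so the
   geometric ratio is [qe 1 ^+ n.+1]. This exponent becomes the factor [n.+1] in the beta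
   parameter. *)
have PF t : P (F t) = (G * (qe 1 ^+ n.+1) ^+ t)%:E.
  rewrite IH//; last exact: ltnW.
  congr (_%:E); rewrite big_ltn//.
  rewrite (eq_big_nat _ _ (F2 := fun i => c * qe (k i))); last first.
    by move=> i /andP[ni _]; rewrite /k' leqNgt ni.
  rewrite {1 2}/k' leqnn subnn addr0 /k' leqNgt nm /=.
  rewrite /G /l !qeD (qet t).
  have -> : (qe 1 ^+ n.+1) ^+ t = (qe 1 ^+ t) ^+ n.+1 by rewrite -!exprM mulnC.
  set A := \prod_(_ < _) _; set B := \prod_(_ <= _ < _) _.
  rewrite !exprS !exprMn; ring.
transitivity (\sum_(t <oo) (G * (qe 1 ^+ n.+1) ^+ t)%:E)%E.
  rewrite (eq_eseriesl (Q := xpredT)); last by move=> t; rewrite in_setT.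
  by apply: eq_eseriesr => t _; exact: PF.
rewrite nneseries_geometric; last by rewrite exprn_ge0 ?exprn_ilt1// ltW.
rewrite big_ord_recr/= /G; congr (_%:E); rewrite !exprMn.
set A := \prod_(_ < _) _; set B := \prod_(_ <= _ < _) _; ring.
Qed.

Definition cell_gaps n (j : nat -> nat) : set T :=
  \bigcap_(i in `I_n) [set w | K i.+1 w + (j i)%:Z <= K i w].

Lemma measurable_cell_gaps n (j : nat -> nat) : measurable (cell_gaps n j).
Proof. by apply: bigcap_measurableType => i _; exact: measurable_cell_gap. Qed.

(** Given the value of [K n], [cell_gap_prob] isolates the dependence on [j] in a factor that is the
    same for every value. What remains is the corresponding sum for unit gaps, which need not be
    computed. *)
Lemma cell_gap_scaling n (j : nat -> nat) : (forall i, (0 < j i)%N) ->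
  P (cell_gaps n j) =
  ((\prod_(i < n) expR (- (alpha * h)) ^+ (i.+1 * (j i).-1))%:E *
   P (cell_gaps n (fun=> 1%N)))%E.
Proof.
move=> jn; set rho := \prod_(i < n) _.
pose L t := if @pickle_inv int t is Some z then [set w | K n w = z] else set0.
have mL t : measurable (L t).
  by rewrite /L; case: pickle_inv => // z; exact: measurable_cell_eq.
have tL : trivIset setT L.
  apply/trivIsetP => t u _ _ tu; rewrite -subset0 => w [].
  have tK := @pickle_invK int t; have uK := @pickle_invK int u.
  move: tK uK; rewrite /L; case: pickle_inv => //= z zt; case: pickle_inv => //= z' zu.
  by move=> Ez Ez'; move: tu; rewrite -zt -zu -Ez -Ez' eqxx.
have LT : \bigcup_t L t = setT.
  rewrite -subTset => w _; exists (choice.pickle (K n w)); first exact: I.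
  by rewrite /L pickleK_inv.
have split_sum A : measurable A -> P A = (\sum_(t <oo) P (A `&` L t))%E.
  move=> mA; rewrite -[A in LHS]setIT -LT setI_bigcupr measure_bigcup//.
  - by rewrite (eq_eseriesl (Q := xpredT))// => t; rewrite in_setT.
  - by move=> t _; exact: measurableI.
  - exact: trivIset_setIl.
rewrite split_sum; last exact: measurable_cell_gaps.
rewrite [X in (_ * X)%E]split_sum; last exact: (measurable_cell_gaps n (fun=> 1%N)).
rewrite -nneseriesZl//; apply: eq_eseriesr => t _.
rewrite /L; case: pickle_inv => [z|]; last by rewrite !setI0 measure0 mule0.
(* Any strictly decreasing sequence with value [z] at [n] would do. *)
pose k i : int := z + n%:Z - i%:Z.
have k_decr i : k i.+1 < k i by rewrite /k; lia.
have LE : [set w | K n w = z] =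
    \bigcap_(i in [set i | (n <= i <= n)%N]) [set w | K i w = k i].
  apply/seteqP; split => w /=.
    by move=> Kz i /=; rewrite -eqn_leq => /eqP <-; rewrite Kz /k; lia.
  by move=> /(_ n); rewrite /= leqnn => /(_ isT) ->; rewrite /k; lia.
rewrite LE [LHS](cell_gap_prob jn)// [X in (_ * X)%E](cell_gap_prob (j := fun=> 1%N))//.
suff AE : \prod_(i < n) (c * qe (j i)%:Z ^+ i.+1 / (1 - qe 1 ^+ i.+1)) =
    rho * \prod_(i < n) (c * qe 1%N%:Z ^+ i.+1 / (1 - qe 1 ^+ i.+1)).
  by rewrite AE -!mulrA EFinM.
rewrite /rho -big_split/=; apply: eq_bigr => i _.
have jE : (j i)%:Z = (j i).-1%:Z + 1 by have := jn i; lia.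
have -> : qe (j i)%:Z ^+ i.+1 = expR (- (alpha * h)) ^+ (i.+1 * (j i).-1) * qe 1 ^+ i.+1.
  rewrite jE qeD exprMn; congr (_ * _).
  rewrite /qe -expRM_natl -expRM_natl; congr expR; rewrite natrM.
  have -> : ((j i).-1%:Z)%:~R = (j i).-1%:R :> R by [].
  ring.
ring.
Qed.

End discretization.

(** * The ratios of successive jumps *)

Section gap_law.
Context d (T : measurableType d) (R : realType) (P : probability T R).
Variables (C alpha : R) (C_gt0 : 0 < C) (alpha_gt0 : 0 < alpha).
Variables (Delta : nat -> {RV P >-> R}) (jumps : stable_jumps P C alpha Delta).

Definition log_gaps n (y : nat -> R) : set T :=
  \bigcap_(i in `I_n) [set w | ln (Delta i.+1 w) + y i <= ln (Delta i w)].

Lemma measurable_log_gaps n y : measurable (log_gaps n y).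
Proof.
apply: bigcap_measurableType => i _; apply: measurable_le_set.
  by apply: measurable_funD => //; exact: measurable_ln_jump.
exact: measurable_ln_jump.
Qed.

Let cell_ge (h : R) i (j : nat) w : 0 < h ->
  ln (Delta i.+1 w) + h * j%:R <= ln (Delta i w) ->
  log_cell Delta h i.+1 w + j%:Z <= log_cell Delta h i w.
Proof.
move=> h0 gap; rewrite /log_cell floor_ge_int intrD ler_pdivlMr//.
have -> : (j%:Z)%:~R = j%:R :> R by [].
apply: le_trans gap; rewrite mulrDl lerD// ?(mulrC h)//.
by rewrite -ler_pdivlMr// floor_le_tmp.
Qed.

(** The two points may sit at the facing ends of their cells, which costs up to one cell: hence
    [j.+1]. *)
Let cell_le (h : R) i (j : nat) w : 0 < h ->
  log_cell Delta h i.+1 w + j.+1%:Z <= log_cell Delta h i w ->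
  ln (Delta i.+1 w) + h * j%:R <= ln (Delta i w).
Proof.
move=> h0; rewrite {2}/log_cell floor_ge_int intrD ler_pdivlMr//.
apply: le_trans; have -> : (j.+1%:Z)%:~R = 1 + j%:R :> R by rewrite addrC natr1.
rewrite addrA mulrDl lerD ?(mulrC h)// -ler_pdivrMr// ltW//.
have := floorD1_gt (ln (Delta i.+1 w) / h).
by rewrite intrD.
Qed.

(** Finitely many positive gaps all exceed the mesh eventually. This makes the factor left open by
    [cell_gap_scaling] tend to 1. *)
Lemma log_gaps_cvg1 n :
  fine (P (log_gaps n (fun=> N.+1%:R^-1))) @[N --> \oo] --> (1 : R).
Proof.
apply: fine_cvg.
have -> : 1%:E = P (\bigcup_N log_gaps n (fun=> N.+1%:R^-1)).
  rewrite -(probability_setT P); apply: ae_eq_measure => //.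
    by apply: bigcupT_measurable => N; exact: measurable_log_gaps.
  case: (jumps_decreasing jumps) => Z [mZ Z0 HZ]; exists Z; split => //.
  apply: subset_trans HZ; apply: subsetC => w /= Hw; split => // _.
  elim: n => [|n [N _ IH]]; first by exists 0%N.
  have gap0 : 0 < ln (Delta n w) - ln (Delta n.+1 w).
    by rewrite subr_gt0; case/andP: (Hw n) => D0 D1; rewrite ltr_ln ?posrE// (lt_trans D0).
  have [N' _ HN'] : \forall k \near \oo, k.+1%:R^-1 < ln (Delta n w) - ln (Delta n.+1 w).
    exact: near_infty_natSinv_lt (PosNum gap0).
  exists (maxn N N') => // i /=; rewrite ltnS leq_eqVlt => /predU1P[->|ni].
    rewrite addrC -lerBrDr ltW//; apply: HN'.
    exact: leq_maxr.
  apply: le_trans (IH i ni); rewrite lerD2l lef_pV2 ?posrE// ler_nat ltnS.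
  exact: leq_maxl.
apply: nondecreasing_cvg_mu.
- by move=> N; exact: measurable_log_gaps.
- by apply: bigcupT_measurable => N; exact: measurable_log_gaps.
- move=> N N' NN'; apply/subsetPset => w H i ni; apply: le_trans (H i ni).
  by rewrite lerD2l lef_pV2 ?posrE// ler_nat ltnS.
Qed.

Variables (n : nat) (y : nat -> R).
Hypothesis y_ge0 : forall i, 0 <= y i.

Let A := \sum_(i < n) alpha * i.+1%:R * y i.
Let B := \sum_(i < n) alpha * i.+1%:R.

Let prodE (h : R) (e : nat -> nat) :
  \prod_(i < n) expR (- (alpha * h)) ^+ (i.+1 * e i) =
  expR (- \sum_(i < n) alpha * i.+1%:R * (h * (e i)%:R)).
Proof.
rewrite -sumrN expR_sum; apply: eq_bigr => i _.
by rewrite -expRM_natl; congr expR; rewrite natrM; ring.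
Qed.

Let p := fine (P (log_gaps n y)).
Let F (h : R) := fine (P (cell_gaps Delta h n (fun=> 1%N))).

Let F_le1 h : F h <= 1.
Proof.
rewrite -lee_fin fineK ?probability_le1//; last first.
  by rewrite fin_num_measure//; exact: measurable_cell_gaps.
exact: measurable_cell_gaps.
Qed.

Let F_ge0 h : 0 <= F h. Proof. exact: fine_ge0. Qed.

Let scaling h (j : nat -> nat) : 0 < h -> (forall i, (0 < j i)%N) ->
  fine (P (cell_gaps Delta h n j)) =
  expR (- \sum_(i < n) alpha * i.+1%:R * (h * (j i).-1%:R)) * F h.
Proof.
move=> h0 j0; rewrite (cell_gap_scaling C_gt0 alpha_gt0 jumps h0)//
  (prodE h (fun i => (j i).-1)).
by rewrite fineM ?fin_num_measure//; exact: measurable_cell_gaps.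
Qed.

(* [p] is squeezed between probabilities of gaps of the discretized logarithms;
   the scaling lemma makes both explicit up to the common factor [F h]. *)
Let lower h : 0 < h -> expR (- (A + h * B)) * F h <= p.
Proof.
move=> h0; pose t i := Num.truncn (y i / h).
have tE i : y i <= h * (t i).+1%:R <= y i + h.
  have yh0 : 0 <= y i / h by rewrite divr_ge0// ltW.
  have := truncn_itv yh0; rewrite -/(t i) => /andP[t1 t2]; apply/andP; split.
    by rewrite mulrC -ler_pdivrMr// ltW.
  by rewrite -natr1 mulrDr mulr1 lerD2r mulrC -ler_pdivlMr.
(* One unit makes up for rounding [y i / h] down, the other for the cell lost in [cell_le]. *)
apply: (@le_trans _ _ (fine (P (cell_gaps Delta h n (fun i => (t i).+2))))).
  rewrite scaling//= ler_wpM2r// ler_expR lerN2 /A /B mulr_sumr -big_split/=.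
  apply: ler_sum => i _; rewrite (mulrC h (alpha * _)) -mulrDr.
  apply: ler_wpM2l; first by rewrite mulr_ge0// ltW.
  by case/andP: (tE i).
rewrite fine_le ?fin_num_measure//; first last.
- apply: le_measure; rewrite ?inE.
  + exact: measurable_cell_gaps.
  + exact: measurable_log_gaps.
  move=> w H i ni; have /cell_le := H i ni.
  by move=> /(_ h0); apply: le_trans; rewrite lerD2l; case/andP: (tE i).
- exact: measurable_log_gaps.
- exact: measurable_cell_gaps.
Qed.

Let upper h : 0 < h -> p <= expR (- (A - 2 * h * B)) * F h + (1 - F h).
Proof.
move=> h0; pose t i := Num.truncn (y i / h).
(* The scaling lemma wants positive gaps. Raising a zero to one is harmless where all cell gaps are
   at least one; the exceptional event has probability [1 - F h]. *)
pose j i := maxn 1 (t i).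
have tE i : h * (t i)%:R <= y i < h * (t i).+1%:R.
  have yh0 : 0 <= y i / h by rewrite divr_ge0// ltW.
  have := truncn_itv yh0; rewrite -/(t i) => /andP[t1 t2]; apply/andP; split.
    by rewrite mulrC -ler_pdivlMr.
  by rewrite mulrC -ltr_pdivrMr.
have mG := measurable_cell_gaps Delta h n.
have pF (S : set T) : measurable S -> P S \is a fin_num.
  by move=> mS; rewrite fin_num_measure.
have j0 i : (0 < j i)%N by rewrite /j leq_max.
apply: (@le_trans _ _ (fine (P (cell_gaps Delta h n j)) + (1 - F h))); last first.
  rewrite lerD2r scaling// ler_wpM2r// ler_expR lerN2 /A /B mulr_sumr -sumrB.
  apply: ler_sum => i _; rewrite (mulrC (2 * h) (alpha * _)) -mulrBr.
  apply: ler_wpM2l; first by rewrite mulr_ge0// ltW.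
  have /andP[_] := tE i; rewrite /j; case: (t i) => [|k] yh.
    by rewrite /= mulr0 subr_le0 ltW// (lt_trans yh)// mulr1 ltr_pMl// ltr1n.
  rewrite (maxn_idPr _)//= lerBlDr; apply: le_trans (ltW yh) _.
  by rewrite -addn2 natrD mulrDr lerD2l mulrC.
have -> : 1 - F h = fine (P (~` cell_gaps Delta h n (fun=> 1%N))).
  by rewrite probability_setC// fineB ?pF.
rewrite -fineD ?pF//; last exact: measurableC.
rewrite fine_le ?fin_numD ?pF//.
- exact: measurable_log_gaps.
- by apply: measurableC.
have mGC := measurableC (mG (fun=> 1%N)).
apply: (le_trans _ (measureU2 _ _ _)) => //.
apply: le_measure; rewrite ?inE.
- exact: measurable_log_gaps.
- exact: measurableU.
move=> w Hw; have [H1|H1] := pselect (cell_gaps Delta h n (fun=> 1%N) w); last by right.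
left => i ni; rewrite /j; case: (leqP 1 (t i)) => t1; last exact: (H1 i ni).
apply: cell_ge => //; apply: le_trans (Hw i ni).
by rewrite lerD2l; case/andP: (tE i).
Qed.

Lemma log_gaps_prob :
  P (log_gaps n y) = (\prod_(i < n) expR (- (alpha * i.+1%:R * y i)))%:E.
Proof.
rewrite -expR_sum sumrN -/A -[LHS]fineK; last first.
  by rewrite fin_num_measure//; exact: measurable_log_gaps.
congr (_%:E); rewrite -/p.
pose h N : R := N.+1%:R^-1.
have h0 N : 0 < h N by rewrite invr_gt0.
have h_cvg : h N @[N --> \oo] --> (0 : R) by exact: cvg_harmonic.
have F1 : F (h N) @[N --> \oo] --> (1 : R).
  apply: (@squeeze_cvgr _ _ _ _ (fun N => fine (P (log_gaps n (fun=> h N)))) (fun=> 1)).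
  - apply: nearW => N; rewrite F_le1 andbT fine_le ?fin_num_measure//.
    + exact: measurable_log_gaps.
    + exact: measurable_cell_gaps.
    apply: le_measure; rewrite ?inE.
    + exact: measurable_log_gaps.
    + exact: measurable_cell_gaps.
    move=> w H i ni; apply: cell_ge => //; rewrite mulr1; exact: H.
  - exact: log_gaps_cvg1.
  - exact: cvg_cst.
(* Used with [c = -2] for the upper bound and [c = 1] for the lower one. *)
have e1 c : expR (- (A + c * h N * B)) * F (h N) @[N --> \oo] --> expR (- A).
  rewrite -[X in _ --> X]mulr1; apply: cvgM => //.
  apply: (@cvg_comp _ _ _ (fun N => - (A + c * h N * B)) expR _ (nbhs (- A)));
    last exact: continuous_expR.
  apply: cvgN; rewrite -[X in _ --> X]addr0; apply: cvgD; first exact: cvg_cst.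
  rewrite -(mul0r B) -(mulr0 c); apply: cvgM; last exact: cvg_cst.
  by apply: cvgM => //; exact: cvg_cst.
apply/eqP; rewrite eq_le; apply/andP; split.
- have := e1 (- 2).
  have F0 : 1 - F (h N) @[N --> \oo] --> (0 : R).
    by rewrite -(subrr 1); apply: cvgB => //; exact: cvg_cst.
  move=> /cvgD /(_ F0); rewrite addr0 => E.
  apply: (@ler_cvg_to _ _ _ _ (fun=> p) _ _ _ (cvg_cst p) E).
  apply: nearW => N; have := upper (h0 N).
  by rewrite (_ : A - 2 * h N * B = A + - 2 * h N * B); last ring.
- apply: (@ler_cvg_to _ _ _ _ _ (fun=> p) _ _ (e1 1) (cvg_cst p)).
  by apply: nearW => N; rewrite mul1r; exact: lower.
Qed.

End gap_law.

Section ratios.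
Context d (T : measurableType d) (R : realType) (P : probability T R).

Definition jump_ratio (Delta : nat -> {RV P >-> R}) (i : nat) (w : T) : R :=
  Delta i.+1 w / Delta i w.

Lemma measurable_jump_ratio Delta i : measurable_fun setT (jump_ratio Delta i).
Proof.
by apply: measurable_funM => //; apply: measurableT_comp => //; exact: measurable_invr.
Qed.

HB.instance Definition _ (Delta : nat -> {RV P >-> R}) (i : nat) :=
  isMeasurableFun.Build _ _ _ _ (jump_ratio Delta i)
    (measurable_jump_ratio Delta i).

(** The beta density becomes a measure as the weighted image of Lebesgue measure under the identity,
    and half-lines determine that measure. *)
Lemma beta1_lawP (a : R) (X : {RV P >-> R}) : 0 < a ->
  beta1_law P a X <->
  forall x, P (X @^-1` `]-oo, x]%classic) = (Num.max 0 (Num.min x 1) `^ a)%:E.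
Proof.
move=> a0; split => [bX x|cX].
  by rewrite bX// integral_beta_itvNyc.
pose g (y : R) := a * y `^ (a - 1) * \1_(`]0, 1[%classic) y.
have mg : measurable_fun [set: measurableTypeR R] g.
  apply: measurable_funM; last exact: measurable_indic.
  by apply: measurable_funM => //; exact: measurable_funTS.
have g0 y : 0 <= g y by rewrite !mulr_ge0 ?powR_ge0// ltW.
have mid : measurable_fun [set: measurableTypeR R] (id : measurableTypeR R -> R) by [].
pose m := weighted_image (@lebesgue_measure R) mg g0 mid.
have mE B : measurable B ->
    m B = (\int[lebesgue_measure]_(x in B `&` `]0%R, 1%R[) (a * x `^ (a - 1))%:E)%E.
  move=> mB; rewrite /m/= /weighted_image [RHS]integral_mkcond; apply: eq_integral => x _.
  rewrite /g patchE !indicE; case: ifPn; rewrite in_setI.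
    by move=> /andP[-> ->]; rewrite !mulr1 mule1.
  by rewrite negb_and => /orP[] /negbTE ->; rewrite ?mulr0 ?mule0 ?mul0e.
move=> B mB; rewrite -mE//.
apply: (@finite_measure_unique_itvNyc R (distribution P X) m) => //.
  by rewrite -ge0_fin_numE// fin_num_measure.
by move=> x; rewrite [RHS]mE// integral_beta_itvNyc//= -cX.
Qed.

Variables (C alpha : R) (C_gt0 : 0 < C) (alpha_gt0 : 0 < alpha).
Variables (Delta : nat -> {RV P >-> R}) (jumps : stable_jumps P C alpha Delta).

Local Notation Q := (jump_ratio Delta).

Lemma jump_ratio_in01 : {ae P, forall w, forall i, 0 < Q i w < 1}.
Proof.
apply: filterS (jumps_decreasing jumps) => w Hw i.
have /andP[D0 D1] := Hw i; have D2 := lt_trans D0 D1.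
by rewrite /jump_ratio divr_gt0//= ltr_pdivrMr// mul1r.
Qed.

(** A ratio is at most [x i] exactly when the logarithmic gap is at least [- ln (x i)]. Capping
    [x i] at 1 keeps this bound nonnegative and loses nothing, the ratios being below 1. *)
Lemma jump_ratio_joint_cdf n (x : nat -> R) :
  P (\bigcap_(i in `I_n) (Q i @^-1` `]-oo, x i]%classic)) =
  (\prod_(i < n) (Num.max 0 (Num.min (x i) 1) `^ (i.+1%:R * alpha)))%:E.
Proof.
have mQ i (z : R) : measurable (Q i @^-1` `]-oo, z]%classic).
  by rewrite -[X in measurable X]setTI; exact: measurable_jump_ratio.
have mcap : measurable (\bigcap_(i in `I_n) (Q i @^-1` `]-oo, x i]%classic)).
  by apply: bigcap_measurableType => i _.
have [x0|] := pselect (forall i, (i < n)%N -> 0 < x i); last first.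
  move=> /existsNP[i /not_implyP[ni /negP]]; rewrite -leNgt => xi.
  rewrite (bigD1 (Ordinal ni))//= max_l; last by rewrite ge_min xi.
  rewrite powR0 ?mul0r ?mulf_neq0 ?gt_eqF//.
  transitivity (P set0); last by rewrite measure0.
  apply: ae_eq_measure => //.
  apply: filterS jump_ratio_in01 => w /(_ i)/andP[Qi _]; split => // /(_ i ni).
  by rewrite /= in_itv/= => /(lt_le_trans Qi)/lt_le_trans/(_ xi); rewrite ltxx.
pose y i := if (i < n)%N then - ln (Num.min (x i) 1) else 0.
have y0 i : 0 <= y i.
  rewrite /y; case: ifPn => // ni.
  by rewrite oppr_ge0 ln_le0// ge_min lexx orbT.
transitivity (P (log_gaps Delta n y)).
  apply: ae_eq_measure => //; first exact: measurable_log_gaps.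
  case: (jumps_decreasing jumps) => Z [mZ Z0 HZ]; exists Z; split => //.
  apply: subset_trans HZ; apply: subsetC => w /= Hw.
  have key i : (i < n)%N -> (Q i w <= x i) <->
      (ln (Delta i.+1 w) + y i <= ln (Delta i w)).
    move=> ni; have /andP[D0 D1] := Hw i; have D2 := lt_trans D0 D1.
    have m0 : 0 < Num.min (x i) 1 by rewrite lt_min x0//= ltr01.
    rewrite /y ni lerBlDr -lnM ?posrE// ler_ln ?posrE ?mulr_gt0//.
    rewrite -ler_pdivrMl// mulrC.
    rewrite le_min -/(Q i w).
    have -> : Q i w <= 1 by rewrite /jump_ratio ler_pdivrMr// mul1r ltW.
    by rewrite andbT.
  by split => H i ni; have := H i ni; rewrite /= ?in_itv/= => /(key i ni).
rewrite (log_gaps_prob C_gt0 alpha_gt0 jumps)//; congr (_%:E).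
apply: eq_bigr => i _; rewrite /y ltn_ord max_r; last by rewrite le_min ltW ?x0//= ler01.
by rewrite /powR gt_eqF ?lt_min ?x0//= mulrN opprK (mulrC alpha).
Qed.

Lemma jump_ratio_cdf i x :
  P (Q i @^-1` `]-oo, x]%classic) = (Num.max 0 (Num.min x 1) `^ (i.+1%:R * alpha))%:E.
Proof.
(* The bound 1 imposes nothing on the other ratios, almost surely. *)
pose y j : R := if j == i then x else 1.
transitivity (P (\bigcap_(j in `I_i.+1) (Q j @^-1` `]-oo, y j]%classic))).
  have mQ j (z : R) : measurable (Q j @^-1` `]-oo, z]%classic).
    by rewrite -[X in measurable X]setTI; exact: measurable_jump_ratio.
  apply: ae_eq_measure => //; first by apply: bigcap_measurableType => j _.
  apply: filterS jump_ratio_in01 => w Qw; split.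
    move=> H j ji; rewrite /y; case: eqP => [->//|_].
    by rewrite /= in_itv/= ltW//; case/andP: (Qw j).
  by move=> /(_ i (ltnSn i)); rewrite /y eqxx.
rewrite jump_ratio_joint_cdf; congr (_%:E).
rewrite (bigD1 ord_max)//= big1 ?mulr1 /y ?eqxx// => j ji.
rewrite ifF; last by apply/negbTE; move: ji; rewrite -val_eqE.
by rewrite minxx max_r// powR1.
Qed.

Lemma jump_ratio_joint_cdf_prod :
  joint_cdf_prod (fun i => Q i : {RV P >-> R}).
Proof.
move=> n x; rewrite [LHS]jump_ratio_joint_cdf -prodEFin.
by apply: eq_bigr => i _; rewrite [RHS]jump_ratio_cdf.
Qed.

Lemma jump_ratio_beta1_law i :
  beta1_law P (i.+1%:R * alpha) (Q i).
Proof.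
by apply/beta1_lawP; [rewrite mulr_gt0|exact: jump_ratio_cdf].
Qed.

End ratios.

(** * Stick-breaking from independent beta variables *)

Section stick_breaking.
Context (R : realType).
Implicit Types x : nat -> R.

Lemma series_Sigma_termS x n N :
  series (Sigma_term x n) N.+1 = x n * (1 + series (Sigma_term x n.+1) N).
Proof.
rewrite /series/= big_nat_recl// mulrDr mulr1 mulr_sumr; congr (_ + _).
  by rewrite /Sigma_term addn1 big_nat1.
apply: eq_bigr => k _; rewrite /Sigma_term big_ltn; last by lia.
by rewrite (addnS n k.+1) addSn.
Qed.

Lemma cvg_series_Sigma_term x n : x n != 0 ->
  cvgn (series (Sigma_term x n)) ->
  cvgn (series (Sigma_term x n.+1)) /\ Sigma x n = x n * (1 + Sigma x n.+1).
Proof.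
move=> xn0 cn.
have cSn : series (Sigma_term x n.+1) N @[N --> \oo] --> Sigma x n / x n - 1.
  rewrite (_ : series (Sigma_term x n.+1) =
      fun N => series (Sigma_term x n) N.+1 / x n - 1); last first.
    by apply/funext => N; rewrite series_Sigma_termS mulrAC divff// mul1r addrAC subrr add0r.
  apply: cvgB; last exact: cvg_cst.
  apply: cvgM; last exact: cvg_cst.
  by rewrite (cvg_shiftS (series (Sigma_term x n))).
split; first by apply/cvg_ex; eexists; exact: cSn.
have -> : Sigma x n.+1 = Sigma x n / x n - 1 by apply/cvg_lim.
by rewrite addrCA subrr addr0 mulrCA divff// mulr1.
Qed.

(** From Sigma_n = x_n (1 + Sigma_{n+1}) one gets 1 - Y_n = x_n (1 + Sigma_{n+1}) / (1 + Sigma_n),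
    and the product of these telescopes. *)
Lemma stick_seqE x : (forall i, 0 < x i) -> cvgn (series (Sigma_term x 0)) ->
  forall n, cvgn (series (Sigma_term x n)) /\
    stick_seq x n = stick_factor x n * \prod_(i < n) (1 - stick_factor x i).
Proof.
move=> x_gt0 c0.
have cn n : cvgn (series (Sigma_term x n)).
  by elim: n => // n /cvg_series_Sigma_term[]//; rewrite gt_eqF.
have SE n : Sigma x n = x n * (1 + Sigma x n.+1).
  by have [] := @cvg_series_Sigma_term x n _ (cn n); rewrite ?gt_eqF.
have S1 n : 0 < 1 + Sigma x n.
  rewrite ltr_pwDl//; apply: limr_ge => //; apply: nearW => N.
  by apply: sumr_ge0 => k _; apply: prodr_ge0 => i _; exact: ltW.
move=> n; split => //; rewrite /stick_seq /stick_factor.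
have -> : \prod_(i < n) (1 - (1 + Sigma x i)^-1) =
    (\prod_(i < n) x i) * (1 + Sigma x n) / (1 + Sigma x 0).
  elim: n => [|n IH]; first by rewrite !big_ord0 mul1r divff// gt_eqF.
  rewrite !big_ord_recr/= IH.
  have -> : 1 - (1 + Sigma x n)^-1 = x n * (1 + Sigma x n.+1) / (1 + Sigma x n).
    by rewrite -SE; field; rewrite gt_eqF.
  by field; rewrite !gt_eqF.
by field; rewrite !gt_eqF.
Qed.

Lemma measurable_stick_seq : measurable_fun setT (@stick_seq R : seqs R -> seqs R).
Proof.
have mprod m n : measurable_fun setT (fun x : seqs R => \prod_(m <= i < n) x i).
  by apply: measurable_prod => i _; exact: measurable_seqs_coord.
apply: measurable_fun_seqs => n; apply: measurable_funM.
  by apply: measurable_prod => i _; exact: measurable_seqs_coord.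
apply: (measurableT_comp (@measurable_invr R)); apply: measurable_funD => //.
apply: (@measurable_fun_limn _ _ _ (fun N (x : seqs R) => series (Sigma_term x 0) N)) => N.
by apply: measurable_sum => k; exact: mprod.
Qed.

End stick_breaking.

(** * Moments and tilting of beta variables *)

Section beta_moments.
Context d (T : measurableType d) (R : realType) (P : probability T R).

(** The cut to the open unit interval, almost surely invisible for beta variables, keeps the values
    in [0, 1] everywhere when [p] is nonnegative, as [expectation_prod] demands. *)
Definition unit_powR (p : R) (B : set R) (x : R) : R :=
  x `^ p * \1_(B `&` `]0, 1[%classic) x.

Lemma unit_powR_itv01 p B x : 0 <= p -> 0 <= unit_powR p B x <= 1.
Proof.
move=> p0; rewrite /unit_powR indicE; case: (boolP (x \in _)); last by rewrite mulr0 lexx ler01.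
rewrite in_setI => /andP[_]; rewrite inE/= in_itv/= => /andP[x0 x1].
rewrite mulr1 powR_ge0/=; have := ge0_ler_powR p0; move=> /(_ x 1).
by rewrite powR1 !nnegrE; apply => //; exact: ltW.
Qed.

Lemma measurable_unit_powR p B : measurable B ->
  measurable_fun setT (unit_powR p B).
Proof.
move=> mB; apply: measurable_funM => //.
by apply: measurable_indic; exact: measurableI.
Qed.

Lemma beta1_law_in01 (a : R) (X : {RV P >-> R}) : 0 < a ->
  beta1_law P a X -> {ae P, forall w, 0 < X w < 1}.
Proof.
move=> a0 bX.
have X1 : P (X @^-1` `]0, 1[) = 1%E.
  by rewrite bX// setIid integral_powR_itv0o// powR1.
exists (~` (X @^-1` `]0, 1[)); split.
- by apply: measurableC; rewrite -[X in measurable X]setTI; exact: measurable_funP.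
- rewrite probability_setC ?X1 ?subee//.
  by rewrite -[X in measurable X]setTI; exact: measurable_funP.
- by apply: subsetC => w /=; rewrite in_itv.
Qed.

(** Tilting Beta(a, 1) by x^p yields Beta(a + p, 1), up to the constant a / (a + p). The set [B] is
    kept for the change of measure. *)
Lemma beta1_moment (a p : R) (B : set R) (X : {RV P >-> R}) :
  0 < a -> 0 <= p -> beta1_law P a X -> measurable B ->
  (\int[P]_w (unit_powR p B (X w))%:E =
   (a / (a + p))%:E * \int[lebesgue_measure]_(x in B `&` `]0%R, 1%R[)
      ((a + p) * x `^ (a + p - 1))%:E)%E.
Proof.
move=> a0 p0 bX mB.
have ap0 : 0 < a + p by rewrite ltr_pwDl.
pose g (y : R) := a * y `^ (a - 1) * \1_(`]0, 1[%classic) y.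
have mg : measurable_fun [set: measurableTypeR R] g.
  apply: measurable_funM; last exact: measurable_indic.
  by apply: measurable_funM => //; exact: measurable_funTS.
have g0 y : 0 <= g y by rewrite !mulr_ge0 ?powR_ge0// ltW.
have mid : measurable_fun [set: measurableTypeR R] (id : measurableTypeR R -> R) by [].
have u0 y : (0 <= (unit_powR p B y)%:E)%E.
  by rewrite lee_fin; case/andP: (unit_powR_itv01 B y p0).
have mu : measurable_fun setT (EFin \o unit_powR p B).
  by apply/measurable_EFinP; exact: measurable_unit_powR.
rewrite -(ge0_integral_distribution X mu)//.
rewrite [LHS](@ge0_integral_weighted_image _ _ _ _ _ (@lebesgue_measure R) g
    (id : measurableTypeR R -> R) mg g0 mid (distribution P X) (EFin \o unit_powR p B))//.
  rewrite -ge0_integralZl//.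
  - rewrite [RHS]integral_mkcond; apply: eq_integral => x _.
    rewrite patchE /g /unit_powR/= !indicE; case: ifPn => xB.
      have x01 : x \in `]0, 1[%classic by move: xB; rewrite in_setI => /andP[].
      rewrite x01 !mulr1 -!EFinM; congr (_%:E).
      move: x01; rewrite inE/= in_itv/= => /andP[x0 _].
      have -> : a + p - 1 = (a - 1) + p by rewrite addrAC.
      rewrite [in RHS]powRD; last by apply/implyP => _; rewrite gt_eqF.
      by field; rewrite gt_eqF.
    by rewrite mulr0 mule0.
  - by apply: measurableI.
  - exact: measurable_beta_density.
  - by move=> x _; rewrite lee_fin mulr_ge0 ?powR_ge0// ltW.
  - by rewrite lee_fin divr_ge0// ltW.
move=> A mA; rewrite [LHS]bX// [LHS]integral_mkcond.
apply: eq_integral => x _; rewrite patchE /g !indicE; case: ifPn; rewrite in_setI.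
  by move=> /andP[-> ->]; rewrite !mulr1 mule1.
by rewrite negb_and => /orP[] /negbTE ->; rewrite ?mulr0 ?mule0 ?mul0e.
Qed.

Lemma beta1_momentT (a p : R) (X : {RV P >-> R}) :
  0 < a -> 0 <= p -> beta1_law P a X ->
  (\int[P]_w (unit_powR p setT (X w))%:E = (a / (a + p))%:E)%E.
Proof.
move=> a0 p0 bX; rewrite (beta1_moment a0 p0 bX)// setTI.
by rewrite integral_powR_itv0o ?powR1 ?mule1// ltr_pwDl.
Qed.

End beta_moments.

Section ae_convergence.
Context d (T : measurableType d) (R : realType) (P : {measure set T -> \bar R}).

Lemma ae_cvg_series (u : nat -> T -> R) :
  (forall n, measurable_fun setT (u n)) -> (forall n w, 0 <= u n w) ->
  (\sum_(n <oo) \int[P]_w (u n w)%:E < +oo)%E ->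
  {ae P, forall w, cvgn (series (u ^~ w))}.
Proof.
move=> mu u0 uoo.
have mu' n : measurable_fun setT (EFin \o u n) by exact/measurable_EFinP.
have int_sum : P.-integrable setT (fun w => \sum_(n <oo) (u n w)%:E)%E.
  apply/integrableP; split.
    apply: (@ge0_emeasurable_sum _ _ _ _ (fun n w => (u n w)%:E) xpredT)
      => [n w _ _|n _]; last exact: mu'.
    by rewrite lee_fin.
  under eq_integral.
    move=> w _; rewrite gee0_abs; last by apply: nneseries_ge0 => n _ _; rewrite lee_fin.
    over.
  by rewrite integral_nneseries// => n w _; rewrite lee_fin.
apply: filterS (integrable_ae measurableT int_sum) => w /(_ I) fin.
apply: nondecreasing_is_cvgn.
  by apply/nondecreasing_seqP => n; rewrite /series/= big_nat_recr//= lerDl.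
exists (fine (\sum_(n <oo) (u n w)%:E)%E) => _ [N _ <-].
rewrite -lee_fin fineK// /series/= -sumEFin.
by apply: nneseries_lim_ge => n _; rewrite lee_fin.
Qed.

Lemma fatou_le (f : nat -> T -> R) (g : T -> R) (K : \bar R) :
  (forall n, measurable_fun setT (f n)) -> (forall n w, 0 <= f n w) ->
  measurable_fun setT g -> (forall w, 0 <= g w) ->
  {ae P, forall w, f n w @[n --> \oo] --> g w} ->
  (forall n, (\int[P]_w (f n w)%:E <= K)%E) -> (\int[P]_w (g w)%:E <= K)%E.
Proof.
move=> mf f0 mg g0 fg fK.
have mf' n : measurable_fun setT (EFin \o f n) by exact/measurable_EFinP.
rewrite (ae_eq_integral (fun w => limn_einf (fun n => (f n w)%:E)))//.
- apply: le_trans (fatou P measurableT mf' _) _.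
    by move=> n w _; rewrite lee_fin.
  rewrite limn_einf_lim; apply: lime_le; first exact: is_cvg_einfs.
  apply: nearW => n; apply: le_trans (fK n).
  by apply: ereal_inf_lbound; exists n => /=.
- exact/measurable_EFinP.
- apply: measurableT_comp => //.
  apply: (measurable_fun_limn_esup (f := fun n w => (- (f n w)%:E)%E)) => n.
  by apply: measurableT_comp => //; exact: mf'.
- apply: filterS fg => w fgw _.
  have : (f n w)%:E @[n --> \oo] --> (g w)%:E by apply: cvg_EFin => //; exact: nearW.
  by move=> /cvg_limn_einf_sup[->].
Qed.

End ae_convergence.

Section beta_sequence.
Context d (T : measurableType d) (R : realType) (P : probability T R).
Variables (alpha : R) (r : nat) (alpha_gt0 : 0 < alpha).
Variable X : nat -> {RV P >-> R}.
Hypothesis jX : joint_cdf_prod X.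
Hypothesis bX : forall i, beta1_law P ((r + i.+1)%:R * alpha) (X i).

Let a (i : nat) := (r + i.+1)%:R * alpha.

Let a_gt0 i : 0 < a i.
Proof. by rewrite mulr_gt0// ltr0n addnS. Qed.

Lemma beta_sequence_in01 : {ae P, forall w, forall i, 0 < X i w < 1}.
Proof. by apply: ae_foralln => i; have := beta1_law_in01 (a_gt0 i) (bX i). Qed.

Lemma expectation_prod_unit_powR n (p : nat -> R) (B : nat -> set R) :
  (forall i, 0 <= p i) -> (forall i, measurable (B i)) ->
  (\int[P]_w (\prod_(i < n) unit_powR (p i) (B i) (X i w))%:E =
   \prod_(i < n) \int[P]_w (unit_powR (p i) (B i) (X i w))%:E)%E.
Proof.
move=> p0 mB; apply: (expectation_prod jX n (F := fun i => unit_powR (p i) (B i))).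
  by move=> i; exact: measurable_unit_powR.
by move=> i y; exact: unit_powR_itv01.
Qed.

Lemma beta_sequence_moment n (p : nat -> R) : (forall i, 0 <= p i) ->
  (\int[P]_w (\prod_(i < n) unit_powR (p i) setT (X i w))%:E =
   (\prod_(i < n) (a i / (a i + p i)))%:E)%E.
Proof.
move=> p0; rewrite (expectation_prod_unit_powR n p0 (fun=> measurableT)) -prodEFin.
by apply: eq_bigr => i _; rewrite (beta1_momentT (a_gt0 i) (p0 i) (bX i)).
Qed.

Lemma measurable_prod_unit_powR n (p : nat -> R) (B : nat -> set R) :
  (forall i, measurable (B i)) ->
  measurable_fun setT (fun w => \prod_(i < n) unit_powR (p i) (B i) (X i w)).
Proof.
move=> mB; apply: measurable_prod => i _.
by apply: measurableT_comp => //; exact: measurable_unit_powR.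
Qed.

Lemma unit_powRT (p x : R) : 0 < x < 1 -> unit_powR p setT x = x `^ p.
Proof.
by move=> x01; rewrite /unit_powR setTI indicE mem_set ?mulr1//= in_itv.
Qed.

Hypothesis alpha_lt1 : alpha < 1.

(** The expected terms are the [q n.+1]. Since [a] increases by steps of [alpha],
    [(1 - alpha) * q n.+1] is a difference of consecutive [a n * q n]; as [alpha < 1], the sum of
    expectations is at most [a 0 / (1 - alpha)]. *)
Lemma beta_sequence_cvg : {ae P, forall w, cvgn (series (Sigma_term (X ^~ w) 0))}.
Proof.
pose u n w := \prod_(i < n.+1) unit_powR 1 setT (X i w).
have u0 n w : 0 <= u n w.
  by apply: prodr_ge0 => i _; case/andP: (unit_powR_itv01 setT (X i w) (@ler01 R)).
have mu n : measurable_fun setT (u n).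
  exact: (measurable_prod_unit_powR n.+1 (fun=> 1) (fun=> measurableT)).
pose q n := \prod_(i < n) (a i / (a i + 1)).
have q0 n : 0 <= q n.
  by apply: prodr_ge0 => i _; rewrite divr_ge0// ?addr_ge0// ltW.
have qS n : (1 - alpha) * q n.+1 = a n * q n - a n.+1 * q n.+1.
  have -> : a n.+1 = a n + alpha.
    by rewrite /a addnS -natr1 mulrDl mul1r.
  have -> : a n * q n = (a n + 1) * q n.+1.
    by rewrite /q big_ord_recr/=; field; rewrite gt_eqF// addr_gt0.
  ring.
have sum_q N : \sum_(0 <= n < N) q n.+1 <= a 0%N / (1 - alpha).
  rewrite ler_pdivlMr ?subr_gt0// mulrC mulr_sumr.
  under eq_bigr do rewrite qS.
  have -> : \sum_(0 <= n < N) (a n * q n - a n.+1 * q n.+1) = a 0%N * q 0%N - a N * q N.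
    elim: N => [|N IH]; first by rewrite big_nil subrr.
    by rewrite big_nat_recr//= IH addrA subrK.
  by rewrite {1}/q big_ord0 mulr1 gerBl; apply: mulr_ge0 => //; exact: ltW.
have := @ae_cvg_series _ _ _ P u mu u0.
have -> : (\sum_(n <oo) \int[P]_w (u n w)%:E = \sum_(n <oo) (q n.+1)%:E)%E.
  by apply: eq_eseriesr => n _; rewrite /u (beta_sequence_moment n.+1 (fun=> @ler01 R)).
have q_lty : (\sum_(n <oo) (q n.+1)%:E < +oo)%E.
  apply: (@le_lt_trans _ _ (a 0%N / (1 - alpha))%:E); last exact: ltry.
  apply: lime_le; first by apply: is_cvg_nneseries => n _ _; rewrite lee_fin.
  by apply: nearW => N; rewrite sumEFin lee_fin.
move=> /(_ q_lty) cu; apply: filterS2 cu beta_sequence_in01 => w cu Xw.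
rewrite (_ : Sigma_term _ _ = u ^~ w)//; apply/funext => n.
rewrite /Sigma_term add0n big_mkord; apply: eq_bigr => i _.
by rewrite unit_powRT// powRr1// ltW//; case/andP: (Xw i).
Qed.

End beta_sequence.

(** * Convergence of the normalized products *)

Section normalized_products.
Context d (T : measurableType d) (R : realType) (P : probability T R).
Variables (alpha : R) (alpha_gt0 : 0 < alpha).
Variable X : nat -> {RV P >-> R}.
Hypothesis jX : joint_cdf_prod X.
Hypothesis bX : forall i, beta1_law P (i.+1%:R * alpha) (X i).

Local Notation Z i w := (unit_powR alpha setT (X i w)).

(** Almost surely this is [frakE_approx alpha] of the stick-breaking sequence of [X]; with indices
    from 0, n V_n^alpha / V_1^alpha has [n.-1] factors. *)
Definition normalized_prod (n : nat) (w : T) : R :=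
  n.+1%:R * \prod_(i < n) Z i w.

Local Notation Y := normalized_prod.

Let Z01 i w : 0 <= Z i w <= 1.
Proof. exact/unit_powR_itv01/ltW. Qed.

Let Z_ge0 i w : 0 <= Z i w. Proof. by case/andP: (Z01 i w). Qed.

Lemma normalized_prod_ge0 n w : 0 <= Y n w.
Proof. by rewrite mulr_ge0// prodr_ge0. Qed.

Lemma measurable_normalized_prod n : measurable_fun setT (Y n).
Proof.
apply: measurable_funM => //.
exact: (measurable_prod_unit_powR X n (fun=> alpha) (fun=> measurableT)).
Qed.

Lemma unit_powRX (p : R) B x e : (0 < e)%N ->
  unit_powR p B x ^+ e = unit_powR (p * e%:R) B x.
Proof.
move=> e0; rewrite /unit_powR exprMn powRrM powR_mulrn ?powR_ge0//.
by congr (_ * _); rewrite indicE; case: (_ \in _); rewrite ?expr1n// expr0n eqn0Ngt e0.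
Qed.

(** [Z i] is Beta(i + 1, 1), so [alpha] cancels. *)
Lemma prod_moment n (e : nat -> nat) : (forall i, (0 < e i)%N) ->
  (\int[P]_w (\prod_(i < n) Z i w ^+ e i)%:E =
   (\prod_(i < n) (i.+1%:R / (i.+1 + e i)%:R))%:E)%E.
Proof.
move=> e0.
have p0 i : 0 <= alpha * (e i)%:R by rewrite mulr_ge0// ltW.
have := @beta_sequence_moment _ _ _ P alpha 0 alpha_gt0 X jX bX n (fun i => alpha * (e i)%:R) p0.
under eq_integral do under eq_bigr do rewrite -unit_powRX//.
move=> ->; congr (_%:E); apply: eq_bigr => i _.
rewrite add0n natrD (mulrC alpha) -mulrDl -mulf_div divff ?mulr1// gt_eqF//.
Qed.

Let ge0_integral_prodZl n (e : nat -> nat) (c : R) : 0 <= c ->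
  (\int[P]_w (c%:E * (\prod_(i < n) Z i w ^+ e i)%:E) =
   c%:E * \int[P]_w (\prod_(i < n) Z i w ^+ e i)%:E)%E.
Proof.
move=> c0; rewrite ge0_integralZl//.
- apply/measurable_EFinP; apply: measurable_prod => i _; apply: measurable_funX.
  by apply: measurableT_comp => //; exact: measurable_unit_powR.
- by move=> w _; rewrite lee_fin prodr_ge0// => i _; rewrite exprn_ge0.
Qed.

(** The product is the inverse of the binomial coefficient of [n + j] over [j]. *)
Lemma prod_moment_cst n j :
  \prod_(i < n) (i.+1%:R / (i.+1 + j)%:R : R) * (n + j)`!%:R = n`!%:R * j`!%:R.
Proof.
elim: n => [|n IH]; first by rewrite big_ord0 !mul1r.
rewrite big_ord_recr/= addSn !factS !natrM.
have n0 : (n + j).+1%:R != 0 :> R by rewrite pnatr_eq0.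
set p := \prod_(_ < _) _ in IH *.
transitivity (n.+1%:R * (p * (n + j)`!%:R)); first by field.
by rewrite IH mulrA.
Qed.

(** The inequality reduces to (n + 1)^j n! <= (n + j)!. The bound, uniform in [n], is the j-th
    moment of the standard exponential law. *)
Lemma normalized_prod_moment_le n j : (\int[P]_w (Y n w ^+ j)%:E <= j`!%:R%:E)%E.
Proof.
case: j => [|j].
  under eq_integral do rewrite expr0.
  by rewrite integral_cst// mul1e fact0 probability_le1.
under eq_integral do rewrite exprMn -prodrXl EFinM.
rewrite (ge0_integral_prodZl n (fun=> j.+1)) ?exprn_ge0//.
rewrite (prod_moment n (e := fun=> j.+1))// -EFinM lee_fin.
have f0 : 0 < (n + j.+1)`!%:R :> R by rewrite ltr0n fact_gt0.
rewrite -(ler_pM2r f0) -mulrA prod_moment_cst mulrA [leRHS]mulrC ler_pM2r ?ltr0n ?fact_gt0//.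
rewrite -natrX -natrM ler_nat; elim: j.+1 => [|k IH]; first by rewrite expn0 mul1n addn0.
rewrite expnS addnS factS -mulnA leq_mul// ltnS; exact: leq_addr.
Qed.

(** Independence of [n] is the martingale property of [Y]: the factors of index from [m] to [n - 1]
    have mean product (m + 1) / (n + 1), which undoes the change of normalization. *)
Let mono_moment m n : (m <= n)%N ->
  (\int[P]_w (Y n w * Y m w)%:E = (2 * m.+1%:R / m.+2%:R)%:E)%E.
Proof.
move=> mn.
pose e i := if (i < m)%N then 2%N else 1%N.
have YE w : Y n w * Y m w = n.+1%:R * m.+1%:R * \prod_(i < n) Z i w ^+ e i.
  rewrite /Y mulrACA; congr (_ * _).
  rewrite -(big_mkord xpredT (fun i => Z i w)) -(big_mkord xpredT (fun i => Z i w)).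
  rewrite -(big_mkord xpredT (fun i => Z i w ^+ e i)) !(big_cat_nat (leq0n m) mn)//=.
  rewrite mulrAC -big_split/=; congr (_ * _); apply: eq_big_nat => i /andP[im1 im2].
    by rewrite /e im2 expr2.
  by rewrite /e ltnNge im1.
under eq_integral do rewrite YE EFinM.
rewrite (ge0_integral_prodZl n e) ?mulr_ge0//.
rewrite prod_moment; last by move=> i; rewrite /e; case: ifP.
rewrite -EFinM; congr (_%:E).
have m2 : m.+2%:R != 0 :> R by rewrite pnatr_eq0.
have m1 : m.+1%:R != 0 :> R by rewrite pnatr_eq0.
rewrite -(big_mkord xpredT (fun i => i.+1%:R / (i.+1 + e i)%:R)) (big_cat_nat (leq0n m) mn)//=.
have -> : \prod_(0 <= i < m) (i.+1%:R / (i.+1 + e i)%:R) = 2 / (m.+1%:R * m.+2%:R) :> R.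
  rewrite (eq_big_nat _ _ (F2 := fun i => i.+1%:R / (i.+1 + 2)%:R)); last first.
    by move=> i /andP[_ im]; rewrite /e im.
  rewrite big_mkord; have := prod_moment_cst m 2.
  rewrite addn2 !factS !natrM fact0 !mulr1.
  have mf : m`!%:R != 0 :> R by rewrite pnatr_eq0 -lt0n fact_gt0.
  have m12f := mulf_neq0 m2 (mulf_neq0 m1 mf).
  move=> E; apply: (mulIf m12f); rewrite E.
  move: m1 m2 mf {E m12f}.
  move: (m.+1%:R) (m.+2%:R) (m`!%:R) => x1 x2 xf x10 x20 xf0; field.
  by rewrite ?x10 ?x20 ?xf0.
have -> : \prod_(m <= i < n) (i.+1%:R / (i.+1 + e i)%:R) = m.+1%:R / n.+1%:R :> R.
  rewrite (eq_big_nat _ _ (F2 := fun i => i.+1%:R / i.+2%:R)); last first.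
    by move=> i /andP[im _]; rewrite /e ltnNge im addn1.
  elim: n mn {YE} => [|n IH].
    by rewrite leqn0 => /eqP ->; rewrite big_geq// divff.
  rewrite leq_eqVlt => /predU1P[<-|]; first by rewrite big_geq// divff.
  rewrite ltnS => mn; rewrite big_nat_recr//= IH//.
  by rewrite mulrA divfK ?pnatr_eq0.
have n1 : n.+1%:R != 0 :> R by rewrite pnatr_eq0.
move: n1 m1 m2; move: (n.+1%:R) (m.+1%:R) (m.+2%:R) => x0 x1 x2 x00 x10 x20.
by field; rewrite ?x00 ?x10 ?x20.
Qed.

Lemma normalized_prod_L2 m n : (m <= n)%N ->
  (\int[P]_w ((Y n w - Y m w) ^+ 2)%:E <= (2 / m.+2%:R)%:E)%E.
Proof.
move=> mn.
have mY := measurable_normalized_prod.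
(* Written without subtraction, the expansion of the square involves integrals of nonnegative
   functions only. *)
have intE : (\int[P]_w ((Y n w - Y m w) ^+ 2)%:E + \int[P]_w (2 * (Y n w * Y m w))%:E =
   \int[P]_w (Y n w * Y n w)%:E + \int[P]_w (Y m w * Y m w)%:E)%E.
  have YY0 i j w : (0 <= (Y i w * Y j w)%:E)%E.
    by rewrite lee_fin mulr_ge0 ?normalized_prod_ge0.
  have YY20 w : (0 <= (2 * (Y n w * Y m w))%:E)%E.
    by have := YY0 n m w; rewrite !lee_fin => H; exact: mulr_ge0.
  have mYY i j : measurable_fun setT (fun w => (Y i w * Y j w)%:E).
    by apply/measurable_EFinP; apply: measurable_funM; exact: mY.
  have mYY2 : measurable_fun setT (fun w => (2 * (Y n w * Y m w))%:E).
    by apply/measurable_EFinP; apply: measurable_funM => //; apply: measurable_funM; exact: mY.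
  have mYB : measurable_fun setT (fun w => ((Y n w - Y m w) ^+ 2)%:E).
    by apply/measurable_EFinP; apply: measurable_funX; apply: measurable_funB; exact: mY.
  rewrite -!ge0_integralD//.
    by apply: eq_integral => w _; rewrite -!EFinD; congr (_%:E); ring.
  by move=> w _; rewrite lee_fin sqr_ge0.
move: intE; rewrite !mono_moment//.
under [X in (_ + X)%E]eq_integral do rewrite EFinM.
rewrite ge0_integralZl//; last 2 first.
- by apply/measurable_EFinP; apply: measurable_funM; exact: mY.
- by move=> w _; rewrite lee_fin mulr_ge0 ?normalized_prod_ge0.
rewrite mono_moment// -EFinM -EFinD.
case: (integral _ _ _) => // x.
rewrite -EFinD => -[] xE; rewrite lee_fin.
have -> : x = 2 * n.+1%:R / n.+2%:R - 2 * m.+1%:R / m.+2%:R.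
  move: xE; set u := 2 * _ / m.+2%:R; set v := 2 * _ / _ => xE.
  by apply: (addIr (2 * u)); rewrite xE; ring.
have twoE k : 2 * k.+1%:R / k.+2%:R = 2 - 2 / k.+2%:R :> R.
  have k2 : k.+2%:R != 0 :> R by rewrite pnatr_eq0.
  have -> : k.+1%:R = k.+2%:R - 1 :> R by rewrite -[k.+2%:R]natr1 addrK.
  by rewrite mulrBr mulr1 mulrBl mulfK.
rewrite !twoE.
by rewrite opprB addrCA addrAC subrr add0r -[leRHS]subr0 lerB// divr_ge0.
Qed.

End normalized_products.

(** * Almost sure convergence through a sparse subsequence *)

Section sparse_subsequence.
Context (R : realType).

(* Sparse enough that the mean-square increments of the normalized products are
   summable with weights, yet with consecutive ratios tending to 1. *)
Definition sparse (k : nat) : nat := ((k.+1 * k.+2) ^ 2)%N.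

Lemma sparse_incr : {homo sparse : i j / (i < j)%N}.
Proof.
apply: homo_ltn => [j i k|i]; first exact: ltn_trans.
by rewrite /sparse ltn_exp2r// [X in (X < _)%N]mulnC ltn_pmul2l.
Qed.

Lemma sparse_gt0 k : (0 < sparse k)%N.
Proof. by rewrite expn_gt0. Qed.

Lemma sparse_floor n k0 : (sparse k0 <= n)%N ->
  exists2 k, (k0 <= k)%N & (sparse k <= n < sparse k.+1)%N.
Proof.
move=> k0n; have sk_ge k : (k <= sparse k)%N.
  by elim: k => // k IH; exact: leq_ltn_trans IH (sparse_incr (ltnSn k)).
have [|k kn kmax] := @ex_maxnP (fun k => sparse k <= n)%N n _ (fun k h => leq_trans (sk_ge k) h).
  by exists k0.
exists k; first exact: kmax.
by rewrite kn ltnNge; apply/negP => /kmax; rewrite ltnn.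
Qed.

Lemma cvg_sparse_ratio :
  ((sparse k.+1).+1%:R / (sparse k).+1%:R : R) @[k --> \oo] --> (1 : R).
Proof.
apply: (@squeeze_cvgr _ _ _ _ (fun=> 1 : R) (fun k => (1 + 2 / k.+1%:R) ^+ 2)).
- apply: nearW => k; apply/andP; split.
    by rewrite ler_pdivlMr// mul1r ler_nat ltnS ltnW// sparse_incr.
  have s0 : 0 < (sparse k)%:R :> R by rewrite ltr0n sparse_gt0.
  apply: (@le_trans _ _ ((sparse k.+1)%:R / (sparse k)%:R)).
    move: (sparse k.+1) (sparse k) (sparse_incr (ltnSn k)) s0 => t s st s0.
    rewrite ler_pdivrMr// mulrAC ler_pdivlMr// -!natr1 mulrDl mulrDr mul1r mulr1.
    by rewrite lerD2l ler_nat ltnW.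
  rewrite ler_pdivrMr// le_eqVlt; apply/orP; left; apply/eqP.
  rewrite /sparse !natrX -exprMn; congr (_ ^+ 2); rewrite !natrM.
  have k1 : k.+1%:R != 0 :> R by rewrite pnatr_eq0.
  have -> : k.+3%:R = k.+1%:R + 2 :> R by rewrite -natrD addn2.
  by field.
- exact: cvg_cst.
- rewrite -[X in _ --> X]mulr1.
  suff H : (1 + 2 / k.+1%:R : R) @[k --> \oo] --> (1 : R) by exact: cvgM.
  rewrite -[X in _ --> X]addr0; apply: cvgD; first exact: cvg_cst.
  rewrite -[X in _ --> X](mulr0 2); apply: cvgM; first exact: cvg_cst.
  exact: cvg_harmonic.
Qed.

(** For [n] between consecutive sparse indices, monotonicity of [U] squeezes the normalized value
    between [(rho k)^-1] times the next sparse value and [rho k] times the previous one, and [rho]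
    tends to 1. *)
Lemma cvg_of_sparse (U : nat -> R) (L : R) :
  (forall n, 0 <= U n) -> (forall m n, (m <= n)%N -> U n <= U m) ->
  (sparse k).+1%:R * U (sparse k) @[k --> \oo] --> L ->
  n.+1%:R * U n @[n --> \oo] --> L.
Proof.
move=> U0 Ud; set Y := fun n : nat => n.+1%:R * U n => YL.
pose rho k : R := (sparse k.+1).+1%:R / (sparse k).+1%:R.
have rho0 k : 0 < rho k by rewrite divr_gt0.
have AL : rho k * Y (sparse k) @[k --> \oo] --> L.
  by rewrite -[X in _ --> X]mul1r; apply: cvgM => //; exact: cvg_sparse_ratio.
have BL : (rho k)^-1 * Y (sparse k.+1) @[k --> \oo] --> L.
  rewrite -[X in _ --> X]mul1r; apply: cvgM.
    by rewrite -[X in _ --> X]invr1; apply: cvgV; [exact: oner_neq0|exact: cvg_sparse_ratio].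
  by rewrite (cvg_shiftS (fun k => Y (sparse k))).
apply/cvgrPdist_lt => e e0.
have /cvgrPdist_lt/(_ _ e0)[k1 _ Hk1] := AL.
have /cvgrPdist_lt/(_ _ e0)[k2 _ Hk2] := BL.
exists (sparse (maxn k1 k2)) => // n /= /sparse_floor[k].
rewrite geq_max => /andP[kk1 kk2] /andP[skn nsk].
have := Hk1 k kk1; have := Hk2 k kk2; rewrite /= !ltr_distlC => /andP[B _] /andP[_ A].
apply/andP; split.
  apply: lt_le_trans B _; rewrite /Y /rho invf_div mulrA divfK ?pnatr_eq0//.
  by rewrite ler_pM ?ler_nat// Ud// ltnW.
apply: le_lt_trans A; rewrite /Y /rho mulrA divfK ?pnatr_eq0//.
by rewrite ler_pM ?ler_nat ?ltnS ?(ltnW nsk)// Ud.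
Qed.

End sparse_subsequence.

Section normalized_products_cvg.
Context d (T : measurableType d) (R : realType) (P : probability T R).
Variables (alpha : R) (alpha_gt0 : 0 < alpha).
Variable X : nat -> {RV P >-> R}.
Hypothesis jX : joint_cdf_prod X.
Hypothesis bX : forall i, beta1_law P (i.+1%:R * alpha) (X i).

Local Notation Y := (normalized_prod alpha X).

Let mY n : measurable_fun setT (Y n).
Proof. exact: measurable_normalized_prod. Qed.

Let Y_ge0 n w : 0 <= Y n w.
Proof. exact: normalized_prod_ge0. Qed.

Lemma normalized_prod_cvg : {ae P, forall w, cvgn (Y ^~ w)}.
Proof.
pose D k w := Y (sparse k.+1) w - Y (sparse k) w.
(* Pointwise |D| <= D^2 / v + v. As [sparse k] is the inverse square of [v k], the mean of D^2 is at
   most 2 v^2, whence E |D| <= 3 v; and the sum of [v] telescopes to at most 1. *)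
pose v k : R := (k.+1%:R * k.+2%:R)^-1.
have v0 k : 0 < v k by rewrite invr_gt0 mulr_gt0.
have mD k : measurable_fun setT (D k) by exact: measurable_funB.
have intD k : (\int[P]_w (`|D k w|)%:E <= (3 * v k)%:E)%E.
  apply: (@le_trans _ _ (\int[P]_w (((v k)^-1)%:E * (D k w ^+ 2)%:E + (v k)%:E)%E)%E).
    apply: ge0_le_integral => //.
    - by apply/measurable_EFinP; exact: measurableT_comp.
    - apply: emeasurable_funD => //; apply: emeasurable_funM => //.
      by apply/measurable_EFinP; exact: measurable_funX.
    - move=> w _; rewrite -EFinM -EFinD lee_fin -(real_normK (num_real (D k w))).
      have [Dv|vD] := leP `|D k w| (v k).
        by rewrite ler_wpDl// mulr_ge0 ?sqr_ge0// invr_ge0 ltW.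
      rewrite ler_wpDr ?(ltW (v0 k))// mulrC ler_pdivlMr// expr2.
      by rewrite ler_wpM2l// ltW.
  have mD2 : measurable_fun setT (fun w => (D k w ^+ 2)%:E).
    by apply/measurable_EFinP; exact: measurable_funX.
  have D20 w : (0 <= (D k w ^+ 2)%:E)%E by rewrite lee_fin sqr_ge0.
  have vV0 : (0 <= ((v k)^-1)%:E)%E by rewrite lee_fin invr_ge0 ltW.
  have vk0 : (0 <= (v k)%:E)%E by rewrite lee_fin ltW.
  have vD20 w : (0 <= ((v k)^-1)%:E * (D k w ^+ 2)%:E)%E by rewrite mule_ge0.
  have mvD2 : measurable_fun setT (fun w => ((v k)^-1)%:E * (D k w ^+ 2)%:E)%E.
    exact: emeasurable_funM.
  have -> : (\int[P]_w (((v k)^-1)%:E * (D k w ^+ 2)%:E + (v k)%:E) =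
      ((v k)^-1)%:E * \int[P]_w (D k w ^+ 2)%:E + (v k)%:E)%E.
    rewrite ge0_integralD// ge0_integralZl//; congr (_ + _)%E.
    rewrite -[RHS]mule1 [LHS]integral_cst//; congr (_ * _)%E; exact: probability_setT.
  have := normalized_prod_L2 alpha_gt0 jX bX (ltnW (sparse_incr (ltnSn k))).
  move=> L2; apply: (@le_trans _ _ (((v k)^-1)%:E * (2 / (sparse k).+2%:R)%:E + (v k)%:E)%E).
    by rewrite leeD2r// lee_wpmul2l// lee_fin invr_ge0 ltW.
  rewrite -EFinM -EFinD lee_fin.
  have -> : 3 * v k = 2 * v k + v k by ring.
  rewrite lerD2r mulrC ler_pdivrMr// -mulrA -expr2 ler_pM2l//.
  rewrite /v exprVn -natrM -natrX lef_pV2 ?posrE// ?ltr0n ?sparse_gt0// ler_nat.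
  exact: (leq_trans (leqnSn _) (leqnSn _)).
have sum_v N : \sum_(0 <= k < N) v k <= 1.
  have -> : \sum_(0 <= k < N) v k = 1 - N.+1%:R^-1.
    elim: N => [|N IH]; first by rewrite big_nil invr1 subrr.
    rewrite big_nat_recr//= IH /v.
    have N1 : N.+1%:R != 0 :> R by rewrite pnatr_eq0.
    have N2 : N.+2%:R != 0 :> R by rewrite pnatr_eq0.
    have N12 : N.+2%:R - N.+1%:R = 1 :> R by rewrite -[N.+2%:R]natr1 addrAC subrr add0r.
    move: N1 N2 N12; move: (N.+1%:R) (N.+2%:R) => x y x0 y0 xy.
    have -> : (x * y)^-1 = x^-1 - y^-1.
      rewrite -[LHS]mul1r -xy; field.
      by rewrite x0 y0.
    by rewrite addrA subrK.
  by rewrite gerBl.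
have := @ae_cvg_series _ _ _ P (fun k w => `|D k w|).
have mnD k : measurable_fun setT (fun w => `|D k w|) by exact: measurableT_comp.
move=> /(_ mnD (fun k w => normr_ge0 _)).
have lty : (\sum_(n <oo) \int[P]_w (`|D n w|)%:E < +oo)%E.
  apply: (@le_lt_trans _ _ (\sum_(n <oo) (3 * v n)%:E)%E).
    apply: lee_nneseries => [n _ _|n _]; first by apply: integral_ge0 => w _; rewrite lee_fin.
    exact: intD.
  apply: (@le_lt_trans _ _ 3%:E); last exact: ltry.
  apply: lime_le.
    by apply: is_cvg_nneseries => n _ _; rewrite lee_fin mulr_ge0// ltW.
  by apply: nearW => N; rewrite sumEFin lee_fin -mulr_sumr -[leRHS]mulr1 ler_pM2l.
move=> /(_ lty); apply: filterS => w /normed_cvg cD.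
have cS : cvgn (fun k => Y (sparse k) w).
  rewrite (_ : (fun k => _) = (fun k => series (D ^~ w) k + Y (sparse 0) w)).
    by apply: is_cvgD => //; exact: is_cvg_cst.
  by apply/funext => k; rewrite /series/= telescope_sumr// subrK.
apply/cvg_ex; exists (limn (fun k => Y (sparse k) w)).
apply: (cvg_of_sparse (U := fun n => \prod_(i < n) unit_powR alpha setT (X i w))) => //.
- move=> n; rewrite prodr_ge0// => i _.
  by case/andP: (unit_powR_itv01 setT (X i w) (ltW alpha_gt0)).
- move=> m n; elim: n => [|n IH]; first by rewrite leqn0 => /eqP ->.
  rewrite leq_eqVlt => /predU1P[->//|/IH]; apply: le_trans.
  rewrite big_ord_recr/= -[leRHS]mulr1 ler_wpM2l//.
    by rewrite prodr_ge0// => i _; case/andP: (unit_powR_itv01 setT (X i w) (ltW alpha_gt0)).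
  by case/andP: (unit_powR_itv01 setT (X n w) (ltW alpha_gt0)).
Qed.

End normalized_products_cvg.

(** * Convergence in mean and of weighted moments *)

Section normalized_products_limit.
Context d (T : measurableType d) (R : realType) (P : probability T R).
Variables (alpha : R) (alpha_gt0 : 0 < alpha).
Variable X : nat -> {RV P >-> R}.
Hypothesis jX : joint_cdf_prod X.
Hypothesis bX : forall i, beta1_law P (i.+1%:R * alpha) (X i).

Local Notation Y := (normalized_prod alpha X).

Variable L : T -> R.
Hypotheses (mL : measurable_fun setT L) (L_ge0 : forall w, 0 <= L w).
Hypothesis YL : {ae P, forall w, Y n w @[n --> \oo] --> L w}.

Let mY n : measurable_fun setT (Y n).
Proof. exact: measurable_normalized_prod. Qed.

Let Y_ge0 n w : 0 <= Y n w.
Proof. exact: normalized_prod_ge0. Qed.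

Let cvgXn (u : nat -> R) (l : R) j : u n @[n --> \oo] --> l ->
  u n ^+ j @[n --> \oo] --> l ^+ j.
Proof.
move=> ul; elim: j => [|j IH]; first exact: cvg_cst.
rewrite exprS; under eq_fun do rewrite exprS.
exact: cvgM.
Qed.

Lemma normalized_prod_limit_L2 n :
  (\int[P]_w ((L w - Y n w) ^+ 2)%:E <= (2 / n.+2%:R)%:E)%E.
Proof.
apply: (@fatou_le _ _ _ P (fun m w => (Y (m + n) w - Y n w) ^+ 2)).
- by move=> m; apply: measurable_funX; exact: measurable_funB.
- by move=> m w; exact: sqr_ge0.
- by apply: measurable_funX; exact: measurable_funB.
- by move=> w; exact: sqr_ge0.
- apply: filterS YL => w Yw; apply: cvgXn; apply: cvgB; last exact: cvg_cst.
  by rewrite (cvg_shiftn n (Y ^~ w)).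
- by move=> m; apply: normalized_prod_L2 => //; exact: leq_addl.
Qed.

Lemma normalized_prod_limit_moment_le j : (\int[P]_w (L w ^+ j)%:E <= j`!%:R%:E)%E.
Proof.
apply: (@fatou_le _ _ _ P (fun m w => Y m w ^+ j)).
- by move=> m; exact: measurable_funX.
- by move=> m w; exact: exprn_ge0.
- exact: measurable_funX.
- by move=> w; exact: exprn_ge0.
- by apply: filterS YL => w Yw; exact: cvgXn.
- by move=> m; exact: normalized_prod_moment_le.
Qed.

(** The rate of the L^2 distance between [L] and [Y n], up to a constant. *)
Let s (n : nat) : R := n.+2%:R^-1 `^ 2^-1.

Let s_gt0 n : 0 < s n. Proof. by rewrite powR_gt0. Qed.

Let s_sqr n : s n * s n = n.+2%:R^-1.
Proof.
rewrite /s -powRD; last by apply/implyP => _; rewrite gt_eqF.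
by rewrite (_ : 2^-1 + 2^-1 = 1) ?powRr1//; field.
Qed.

Let s_cvg : s n @[n --> \oo] --> (0 : R).
Proof.
apply: cvg_powR0 => //.
by rewrite (cvg_shiftS (@harmonic R)); exact: cvg_harmonic.
Qed.

Let ge0_integral_lin (f g : T -> R) (a b : R) :
  measurable_fun setT f -> measurable_fun setT g ->
  (forall w, 0 <= f w) -> (forall w, 0 <= g w) -> 0 <= a -> 0 <= b ->
  (\int[P]_w (a * f w + b * g w)%:E =
   a%:E * \int[P]_w (f w)%:E + b%:E * \int[P]_w (g w)%:E)%E.
Proof.
move=> mf mg f0 g0 a0 b0.
have mf' : measurable_fun setT (EFin \o f) by exact/measurable_EFinP.
have mg' : measurable_fun setT (EFin \o g) by exact/measurable_EFinP.
rewrite -!ge0_integralZl//.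
rewrite -ge0_integralD//.
- by move=> w _; rewrite -EFinM lee_fin mulr_ge0.
- exact: emeasurable_funM.
- by move=> w _; rewrite -EFinM lee_fin mulr_ge0.
- exact: emeasurable_funM.
- by move=> w _; rewrite lee_fin.
- by move=> w _; rewrite lee_fin.
Qed.

(** A weighted Young inequality in place of Cauchy-Schwarz: u v <= u^2 / (2 s) + s v^2 / 2. With s =
    [s n] the first term has mean at most [s n] by the L^2 bound, the second at most
    [M * s n / 2]. *)
Lemma weighted_deviation_le n (W : T -> R) (M : R) :
  measurable_fun setT W -> (\int[P]_w (W w ^+ 2)%:E <= M%:E)%E ->
  (\int[P]_w (`|L w - Y n w| * `|W w|)%:E <= ((1 + M) * s n)%:E)%E.
Proof.
move=> mW WM.
have M0 : 0 <= M.
  rewrite -lee_fin (le_trans _ WM)//; apply: integral_ge0 => w _.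
  by rewrite lee_fin sqr_ge0.
have mD : measurable_fun setT (fun w => L w - Y n w) by exact: measurable_funB.
pose a := (2 * s n)^-1; pose b := s n / 2.
have a0 : 0 <= a by rewrite invr_ge0 mulr_ge0// ltW.
have b0 : 0 <= b by rewrite divr_ge0// ltW.
apply: (@le_trans _ _ (\int[P]_w (a * (L w - Y n w) ^+ 2 + b * W w ^+ 2)%:E)%E).
  apply: ge0_le_integral => //.
  - by apply/measurable_EFinP; apply: measurable_funM; exact: measurableT_comp.
  - by apply/measurable_EFinP; apply: measurable_funD;
      apply: measurable_funM => //; exact: measurable_funX.
  - move=> w _; rewrite lee_fin -(real_normK (num_real (L w - Y n w))).
    rewrite -(real_normK (num_real (W w))).
    move: `|L w - Y n w| `|W w| => u v; rewrite /a /b -subr_ge0.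
    have -> : (2 * s n)^-1 * u ^+ 2 + s n / 2 * v ^+ 2 - u * v =
        (2 * s n)^-1 * (u - s n * v) ^+ 2.
      by field; rewrite gt_eqF.
    by rewrite mulr_ge0// sqr_ge0.
rewrite ge0_integral_lin//; last 4 first.
- exact: measurable_funX.
- exact: measurable_funX.
- by move=> w; exact: sqr_ge0.
- by move=> w; exact: sqr_ge0.
apply: (@le_trans _ _ (a%:E * (2 / n.+2%:R)%:E + b%:E * M%:E)%E).
  by apply: leeD; rewrite lee_wpmul2l ?lee_fin//; exact: normalized_prod_limit_L2.
rewrite -!EFinM -EFinD lee_fin -s_sqr [leRHS]mulrDl [X in _ <= X + _]mul1r; apply: lerD.
  rewrite le_eqVlt; apply/orP; left; apply/eqP; rewrite /a.
  by field; rewrite gt_eqF.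
rewrite /b mulrC; apply: ler_wpM2l => //.
by rewrite ler_pdivrMr// ler_peMr ?(ltW (s_gt0 n))// ler1n.
Qed.

(** Common source of the L^p convergence and of the convergence of r-th powers: it suffices to split
    off one factor [|L - Y n|] and bound the rest in L^2. *)
Let weighted_deviation_cvg0 (f : nat -> T -> R) (W : nat -> T -> R) (M : R) :
  (forall n, measurable_fun setT (f n)) -> (forall n w, 0 <= f n w) ->
  (forall n, measurable_fun setT (W n)) ->
  (forall n, (\int[P]_w (W n w ^+ 2)%:E <= M%:E)%E) ->
  (forall n w, f n w <= `|L w - Y n w| * `|W n w|) ->
  (\int[P]_w (f n w)%:E)%E @[n --> \oo] --> 0%E.
Proof.
move=> mf f0 mW WM fW.
apply: (@squeeze_cvge _ _ _ _ (fun=> 0%E) _ (fun n => ((1 + M) * s n)%:E)).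
- apply: nearW => n; apply/andP; split.
    by apply: integral_ge0 => w _; rewrite lee_fin.
  apply: le_trans (weighted_deviation_le n (mW n) (WM n)).
  apply: ge0_le_integral => //.
  + by move=> w _; rewrite lee_fin.
  + exact/measurable_EFinP.
  + apply/measurable_EFinP; apply: measurable_funM; apply: measurableT_comp => //.
    exact: measurable_funB.
  + by move=> w _; rewrite lee_fin.
- exact: cvg_cst.
- apply: cvg_EFin; first exact: nearW.
  rewrite -[X in _ --> X](mulr0 (1 + M)); apply: cvgM => //; exact: cvg_cst.
Qed.

Let deviationX n w j : `|L w - Y n w| ^+ j <= L w ^+ j + Y n w ^+ j.
Proof.
have [LY|YL'] := leP (L w) (Y n w).
  rewrite ler_wpDl ?exprn_ge0// lerXn2r ?nnegrE//.
  by rewrite ler0_norm ?subr_le0// opprB gerBl.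
rewrite ler_wpDr ?exprn_ge0// lerXn2r ?nnegrE//.
by rewrite gtr0_norm ?subr_gt0// gerBl.
Qed.

Let sqrD_le (u v : R) : (u + v) ^+ 2 <= 2 * u ^+ 2 + 2 * v ^+ 2.
Proof.
rewrite -subr_ge0; have -> : 2 * u ^+ 2 + 2 * v ^+ 2 - (u + v) ^+ 2 = (u - v) ^+ 2 by ring.
exact: sqr_ge0.
Qed.

Let moment_sum_le n j (a b : R) : 0 <= a -> 0 <= b ->
  (\int[P]_w (a * L w ^+ j + b * Y n w ^+ j)%:E <= ((a + b) * j`!%:R)%:E)%E.
Proof.
move=> a0 b0; rewrite ge0_integral_lin//; last 4 first.
- exact: measurable_funX.
- exact: measurable_funX.
- by move=> w; exact: exprn_ge0.
- by move=> w; exact: exprn_ge0.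
rewrite mulrDl EFinD !EFinM; apply: leeD; rewrite lee_wpmul2l ?lee_fin//.
  exact: normalized_prod_limit_moment_le.
exact: normalized_prod_moment_le.
Qed.

Lemma normalized_prod_Lp (p : R) : 1 <= p ->
  (\int[P]_w (`|Y n w - L w| `^ p)%:E)%E @[n --> \oo] --> 0%E.
Proof.
move=> p1; pose k := Num.truncn p.
have pk : p <= k.+1%:R by rewrite ltW// Num.Theory.truncnS_gt.
(* With D the deviation and 1 <= p <= k + 1, D^p is at most D when D <= 1 and at most D^(k+1)
   otherwise, hence at most D (1 + D^k). *)
pose W n w := 1 + `|L w - Y n w| ^+ k.
have mW n : measurable_fun setT (W n).
  apply: measurable_funD => //; apply: measurable_funX.
  by apply: measurableT_comp => //; exact: measurable_funB.
apply: (@weighted_deviation_cvg0 _ W (2 + 4 * (k * 2)`!%:R)) => //.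
- move=> n; apply: (@measurableT_comp _ _ _ _ _ _ (@powR R ^~ p)) => //.
  by apply: measurableT_comp => //; exact: measurable_funB.
- move=> n.
  apply: (@le_trans _ _ (\int[P]_w (2 * 1 + 1 * (2 * L w ^+ (k * 2) + 2 * Y n w ^+ (k * 2)))%:E)%E).
    apply: ge0_le_integral => //.
    + by move=> w _; rewrite lee_fin sqr_ge0.
    + by apply/measurable_EFinP; exact: measurable_funX.
    + apply/measurable_EFinP; apply: measurable_funD => //; apply: measurable_funM => //.
      by apply: measurable_funD; apply: measurable_funM => //; exact: measurable_funX.
    + move=> w _; rewrite lee_fin /W (le_trans (sqrD_le _ _))// expr1n mul1r lerD2l.
      by rewrite -mulrDr ler_pM2l// -exprM.
  rewrite (@ge0_integral_lin (fun=> 1)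
    (fun w => 2 * L w ^+ (k * 2) + 2 * Y n w ^+ (k * 2)))//; last 2 first.
  + by apply: measurable_funD; apply: measurable_funM => //; exact: measurable_funX.
  + by move=> w; rewrite addr_ge0 ?mulr_ge0 ?exprn_ge0.
  rewrite [X in (2%:E * X)%E](_ : _ = 1%E); last first.
    rewrite integral_cst// mul1e; exact: probability_setT.
  rewrite mule1 mul1e [leRHS]EFinD leeD2l//.
  have -> : 4 = 2 + 2 :> R by rewrite -natrD.
  exact: moment_sum_le.
- move=> n w; rewrite distrC; set D := `|_|.
  have D0 : 0 <= D by exact: normr_ge0.
  rewrite ger0_norm; last by rewrite addr_ge0// exprn_ge0.
  rewrite /W -/D mulrDr mulr1 -exprS.
  have [D1|D1] := leP D 1.
    apply: ler_wpDr; first exact: exprn_ge0.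
    have [->|Dn0] := eqVneq D 0; first by rewrite powR0// gt_eqF// (lt_le_trans ltr01).
    by apply: ge1r_powR => //; rewrite D1 lt_neqAle eq_sym Dn0 D0.
  apply: ler_wpDl => //; rewrite -powR_mulrn//.
  by apply: ler_powR => //; exact: ltW.
Qed.

Let diffX_le (u v : R) (r : nat) : 0 <= u -> 0 <= v -> (0 < r)%N ->
  `|u ^+ r - v ^+ r| <= `|u - v| * (r%:R * (u ^+ r.-1 + v ^+ r.-1)).
Proof.
move=> u0 v0 r0; rewrite subrXX normrM ler_wpM2l//.
apply: (le_trans (ler_norm_sum _ _ _)).
rewrite -[r in r%:R]card_ord mulr_natl -sumr_const; apply: ler_sum => i _.
rewrite ger0_norm ?mulr_ge0 ?exprn_ge0//.
have [uv|vu] := leP u v.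
  apply: ler_wpDl; first exact: exprn_ge0.
  have -> : v ^+ r.-1 = v ^+ (r.-1 - i) * v ^+ i.
    by rewrite -exprD; congr (_ ^+ _); have := ltn_ord i; lia.
  by apply: ler_pM; rewrite ?exprn_ge0// lerXn2r ?nnegrE.
apply: ler_wpDr; first exact: exprn_ge0.
have -> : u ^+ r.-1 = u ^+ (r.-1 - i) * u ^+ i.
  by rewrite -exprD; congr (_ ^+ _); have := ltn_ord i; lia.
by apply: ler_pM; rewrite ?exprn_ge0// lerXn2r ?nnegrE// ltW.
Qed.

Lemma normalized_prodX_cvg (r : nat) (S : set T) : (0 < r)%N -> measurable S ->
  (\int[P]_w (Y n w ^+ r * \1_S w)%:E)%E @[n --> \oo] --> (\int[P]_w (L w ^+ r * \1_S w)%:E)%E.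
Proof.
move=> r0 mS.
pose W n w := r%:R * (L w ^+ r.-1 + Y n w ^+ r.-1).
have mW n : measurable_fun setT (W n).
  by apply: measurable_funM => //; apply: measurable_funD; exact: measurable_funX.
pose e n := (\int[P]_w (`|L w ^+ r - Y n w ^+ r|)%:E)%E.
have m1 : measurable_fun setT (\1_S : T -> R) by exact: measurable_indic.
have me n : measurable_fun setT (fun w => `|L w ^+ r - Y n w ^+ r|).
  by apply: measurableT_comp => //; apply: measurable_funB; exact: measurable_funX.
have e0 : e n @[n --> \oo] --> 0%E.
  (* The factorization of a difference of r-th powers gives [W]; the constant comes from (u + v)^2
     <= 2 u^2 + 2 v^2 and the moment bounds of order [r.-1 * 2]. *)
  apply: (@weighted_deviation_cvg0 _ W (4 * r%:R ^+ 2 * (r.-1 * 2)`!%:R)) => //.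
  - move=> n; pose a : R := 2 * r%:R ^+ 2.
    have a0 : 0 <= a by rewrite mulr_ge0// exprn_ge0.
    apply: (@le_trans _ _ (\int[P]_w (a * L w ^+ (r.-1 * 2) + a * Y n w ^+ (r.-1 * 2))%:E)%E).
      apply: ge0_le_integral => //.
      + by move=> w _; rewrite lee_fin sqr_ge0.
      + by apply/measurable_EFinP; exact: measurable_funX.
      + by apply/measurable_EFinP; apply: measurable_funD;
          apply: measurable_funM => //; exact: measurable_funX.
      + move=> w _; rewrite lee_fin /W exprMn.
        have aE (x y : R) : a * x + a * y = r%:R ^+ 2 * (2 * x + 2 * y) by rewrite /a; ring.
        rewrite aE; apply: ler_wpM2l; first exact: exprn_ge0.
        rewrite !exprM; exact: sqrD_le.
    apply: (le_trans (moment_sum_le n _ a0 a0)); rewrite lee_fin.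
    by rewrite (_ : a + a = 4 * r%:R ^+ 2)//; rewrite /a; ring.
  - move=> n w; rewrite [X in _ * X]ger0_norm; last first.
      by rewrite mulr_ge0// addr_ge0// exprn_ge0.
    exact: diffX_le.
have int_ge0 n : (0 <= \int[P]_w (Y n w ^+ r * \1_S w)%:E)%E.
  by apply: integral_ge0 => w _; rewrite lee_fin mulr_ge0// exprn_ge0.
have mfin (f : T -> R) : measurable_fun setT f -> (forall w, 0 <= f w) ->
    measurable_fun setT (fun w => (f w ^+ r * \1_S w)%:E).
  by move=> mf f0; apply/measurable_EFinP; apply: measurable_funM => //; exact: measurable_funX.
have le_int (f g : T -> R) n : measurable_fun setT f -> measurable_fun setT g ->
    (forall w, 0 <= f w) -> (forall w, 0 <= g w) ->
    (forall w, `|f w ^+ r - g w ^+ r| = `|L w ^+ r - Y n w ^+ r|) ->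
    (\int[P]_w (f w ^+ r * \1_S w)%:E <= \int[P]_w (g w ^+ r * \1_S w)%:E + e n)%E.
  move=> mf mg f0 g0 fg.
  have gS0 w : (0 <= (g w ^+ r * \1_S w)%:E)%E by rewrite lee_fin mulr_ge0// exprn_ge0.
  have fS0 w : (0 <= (f w ^+ r * \1_S w)%:E)%E by rewrite lee_fin mulr_ge0// exprn_ge0.
  have mgS := mfin g mg g0; have mfS := mfin f mf f0.
  have me' : measurable_fun setT (fun w => (`|L w ^+ r - Y n w ^+ r|)%:E) by exact/measurable_EFinP.
  rewrite /e -ge0_integralD//.
  apply: ge0_le_integral => //; first exact: emeasurable_funD.
  move=> w _; rewrite -EFinD lee_fin -fg indicE.
  case: (w \in S); rewrite ?mulr1 ?mulr0 ?addr_ge0//.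
  by rewrite -lerBlDl ler_norm.
have fin (f : T -> R) : measurable_fun setT f -> (forall w, 0 <= f w) ->
    (\int[P]_w (f w ^+ r)%:E <= r`!%:R%:E)%E ->
    (\int[P]_w (f w ^+ r * \1_S w)%:E)%E \is a fin_num.
  move=> mf f0 fr; rewrite ge0_fin_numE; last first.
    by apply: integral_ge0 => w _; rewrite lee_fin mulr_ge0// exprn_ge0.
  apply: (@le_lt_trans _ _ r`!%:R%:E); last exact: ltry.
  apply: le_trans fr; apply: ge0_le_integral => //.
  - by move=> w _; rewrite lee_fin mulr_ge0// exprn_ge0.
  - exact: mfin.
  - by apply/measurable_EFinP; exact: measurable_funX.
  - move=> w _; rewrite lee_fin indicE.
    by case: (w \in S); rewrite ?mulr1 ?mulr0 ?exprn_ge0.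
have finL := fin L mL L_ge0 (normalized_prod_limit_moment_le r).
apply: (@squeeze_cvge _ _ _ _
  (fun n => \int[P]_w (L w ^+ r * \1_S w)%:E - e n)%E _
  (fun n => \int[P]_w (L w ^+ r * \1_S w)%:E + e n)%E).
(* The lower bound subtracts [e n], whose finiteness for large [n] is read off its convergence to
   0. *)
- have [N _ HN] : \forall n \near \oo, e n \is a fin_num by exact: (cvg_is_fine e0).
  exists N => // n Nn; have en := HN n Nn; apply/andP; split.
    by rewrite leeBlDr//; apply: le_int.
  by apply: le_int => // w; rewrite distrC.
- rewrite -[X in _ --> X]sube0; apply: cvgeB => //; first by rewrite fin_num_adde_defl.
  exact: cvg_cst.
- rewrite -[X in _ --> X]adde0; apply: cvgeD => //; first by rewrite fin_num_adde_defl.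
  exact: cvg_cst.
Qed.

End normalized_products_limit.

(** * The laws of the two sequences *)

Section sequence_laws.
Context d (T : measurableType d) (R : realType) (P : probability T R).
Variable X : nat -> {RV P >-> R}.
Hypothesis jX : joint_cdf_prod X.

Lemma measurable_seq_RV : measurable_fun setT (fun w => (X ^~ w : seqs R)).
Proof. by apply: measurable_fun_seqs => n. Qed.

Lemma rectangle_prob n (B : nat -> set R) : (forall i, measurable (B i)) ->
  P [set w | rectangle n B (X ^~ w)] = (\prod_(i < n) P (X i @^-1` B i))%E.
Proof.
move=> mB.
have mXB i : measurable (X i @^-1` B i).
  by rewrite -[X in measurable X]setTI; exact: measurable_funP.
have := expectation_prod jX n (F := fun i => \1_(B i)) (fun i => measurable_indic (mB i)).
have indic01 i y : 0 <= (\1_(B i) y : R) <= 1.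
  by rewrite indicE; case: (_ \in _); rewrite ?lexx ?ler01.
move=> /(_ indic01).
have -> : (\int[P]_w (\prod_(i < n) \1_(B i) (X i w))%:E =
    \int[P]_w (\1_[set w | rectangle n B (X ^~ w)] w)%:E)%E.
  apply: eq_integral => w _; congr (_%:E).
  have [wB|] := pselect (rectangle n B (X ^~ w)).
    rewrite [RHS]indicE mem_set// big1// => i _.
    by rewrite indicE mem_set//; exact: wB.
  move=> wB; rewrite [RHS]indicE memNset//.
  move/existsNP : wB => [i /not_implyP[ni Bi]].
  by rewrite (bigD1 (Ordinal ni))//= indicE memNset// mul0r.
rewrite integral_indic//; last first.
  rewrite -[X in measurable X]setTI; apply: measurable_seq_RV => //.
  exact: measurable_rectangle.
rewrite setIT => ->; apply: eq_bigr => i _.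
by rewrite -[X i @^-1` _]setIT -integral_indic.
Qed.

Lemma joint_cdf_prod_shift r : joint_cdf_prod (fun i => X (r + i)%N).
Proof.
move=> n x.
(* The first [r] coordinates are left free and contribute factors 1. *)
pose B j : set R := if (j < r)%N then setT else `]-oo, x (j - r)%N]%classic.
have := @rectangle_prob (r + n)%N B.
have mB j : measurable (B j) by rewrite /B; case: ifP.
move=> /(_ mB).
have -> : [set w | rectangle (r + n) B (X ^~ w)] =
    \bigcap_(i in `I_n) (X (r + i)%N @^-1` `]-oo, x i]%classic).
  apply/seteqP; split => w H i ni.
    have := H (r + i)%N; rewrite /B ltn_add2l => /(_ ni).
    by rewrite ltnNge leq_addr/= addKn.
  rewrite /B; case: ifPn => //; rewrite -leqNgt => ri.
  have /= := H (i - r)%N; rewrite subnKC//; apply.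
  by rewrite ltn_subLR.
move=> ->; rewrite big_split_ord/= big1 ?mul1e.
  by apply: eq_bigr => i _; rewrite /B ltnNge leq_addr/= addKn.
by move=> i _; rewrite /B ltn_ord preimage_setT; exact: probability_setT.
Qed.

End sequence_laws.

Section law_transfer.
Context d (T : measurableType d) (R : realType) (P : probability T R).
Context d' (T' : measurableType d') (P' : probability T' R).

Lemma sequence_law_unique (X : nat -> {RV P >-> R}) (X' : nat -> {RV P' >-> R}) :
  joint_cdf_prod X -> joint_cdf_prod X' ->
  (forall i B, measurable B -> P (X i @^-1` B) = P' (X' i @^-1` B)) ->
  forall A : set (seqs R), measurable A ->
    P [set w | A (X ^~ w)] = P' [set w | A (X' ^~ w)].
Proof.
move=> jX jX' XX' A mA.
pose mX := isMeasurableFun.Build _ _ _ _ _ (measurable_seq_RV X).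
pose sX : {mfun T >-> seqs R} := HB.pack (fun w => (X ^~ w : seqs R)) mX.
pose mX' := isMeasurableFun.Build _ _ _ _ _ (measurable_seq_RV X').
pose sX' : {mfun T' >-> seqs R} := HB.pack (fun w => (X' ^~ w : seqs R)) mX'.
apply: (@finite_measure_unique_rectangle R (distribution P sX) (distribution P' sX')) => //.
  by rewrite -ge0_fin_numE// fin_num_measure.
move=> n B mB; rewrite [LHS](rectangle_prob jX)// [RHS](rectangle_prob jX')//.
by apply: eq_bigr => i _; exact: XX'.
Qed.

Lemma ge0_integral_has_law d1 (T1 : measurableType d1) (X : T -> T1)
    (mu : probability T1 R) (g : T1 -> \bar R) :
  has_law P X mu -> measurable_fun setT g -> (forall v, (0 <= g v)%E) ->
  (\int[mu]_v g v = \int[P]_w g (X w))%E.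
Proof.
move=> [mX lX] mg g0.
have m1 : measurable_fun [set: T] (fun=> 1 : R) by exact: measurable_cst.
rewrite (@ge0_integral_weighted_image _ _ _ _ _ P (fun=> 1) X m1 (fun=> ler01) mX)//.
  by apply: eq_integral => w _; rewrite mul1e.
move=> A mA; under eq_integral do rewrite mul1e.
have mXA : measurable (X @^-1` A) by rewrite -[X in measurable X]setTI; exact: mX.
by rewrite -[RHS]/(\int[P]_w (\1_(X @^-1` A) w)%:E)%E integral_indic// setIT; apply/esym; exact: lX.
Qed.

End law_transfer.

(** * Trimmed jumps as a stick-breaking sequence *)

Section trimmed_sequence.
Context (R : realType) (D : nat -> R) (r : nat).
Hypothesis D_gt0 : forall n, 0 < D n.

Let x i := D (r + i).+1 / D (r + i)%N.

Let prod_x n : \prod_(i < n) x i = D (r + n)%N / D r.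
Proof.
elim: n => [|n IH]; first by rewrite big_ord0 addn0 divff// gt_eqF.
by rewrite big_ord_recr/= IH /x addnS mulrC mulrA divfK ?gt_eqF.
Qed.

(** Products of consecutive ratios telescope to [D (r + n) / D r], so the trimmed sum is
    [D r * (1 + Sigma x 0)] and [D r] cancels. Convergence of the whole series of [D] comes out as
    well. *)
Lemma stick_seq_ratios : cvgn (series (Sigma_term x 0)) ->
  stick_seq x = (fun n => D (r + n)%N / (limn (series D) - \sum_(i < r) D i)).
Proof.
move=> cx.
have serD N : series D (N + r.+1)%N =
    \sum_(i < r) D i + D r * (1 + series (Sigma_term x 0) N).
  rewrite /series/= mulrDr mulr1 addnC.
  rewrite (big_cat_nat (leq0n r.+1) (leq_addr N r.+1))/= big_mkord big_ord_recr/= -addrA.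
  congr (_ + (_ + _)); rewrite -[X in \sum_(X <= _ < _) _]add0n big_addn addKn mulr_sumr.
  apply: eq_big_nat => k _; rewrite /Sigma_term add0n big_mkord prod_x.
  rewrite mulrC divfK ?gt_eqF//; congr D; lia.
have limD : limn (series D) = \sum_(i < r) D i + D r * (1 + Sigma x 0).
  apply/cvg_lim => //; rewrite -(cvg_shiftn r.+1).
  under eq_fun do rewrite serD.
  apply: cvgD; first exact: cvg_cst.
  apply: cvgM; first exact: cvg_cst.
  by apply: cvgD => //; exact: cvg_cst.
apply/funext => n; rewrite /stick_seq prod_x limD addrAC subrr add0r.
by rewrite invfM mulrA.
Qed.

End trimmed_sequence.

Section trimmed_jumps.
Context d (T : measurableType d) (R : realType) (P : probability T R).
Variables (C alpha : R) (C_gt0 : 0 < C) (alpha_gt0 : 0 < alpha) (alpha_lt1 : alpha < 1).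
Variables (Delta : nat -> {RV P >-> R}) (jumps : stable_jumps P C alpha Delta).

Let Q i : {RV P >-> R} := jump_ratio Delta i.

Lemma shifted_jump_ratio_joint_cdf_prod r : joint_cdf_prod (fun i => Q (r + i)%N).
Proof.
apply: (joint_cdf_prod_shift (X := Q)).
exact: (jump_ratio_joint_cdf_prod C_gt0 alpha_gt0 jumps).
Qed.

Lemma shifted_jump_ratio_beta1_law r i :
  beta1_law P ((r + i.+1)%:R * alpha) (Q (r + i)%N).
Proof. by rewrite addnS; exact: (jump_ratio_beta1_law C_gt0 alpha_gt0 jumps). Qed.

Lemma trimmed_ratio_stick_seq r :
  {ae P, forall w, trimmed_ratio Delta r w = stick_seq (fun i => Q (r + i)%N w)}.
Proof.
have := beta_sequence_cvg alpha_gt0 (shifted_jump_ratio_joint_cdf_prod r)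
  (shifted_jump_ratio_beta1_law r) alpha_lt1.
apply: filterS2 (jumps_decreasing jumps) => w Dw cw.
rewrite (@stick_seq_ratios R (Delta ^~ w) r)//.
by move=> n; case/andP: (Dw n) => /lt_trans; apply.
Qed.

End trimmed_jumps.

(** * Size-biasing by the limit of the normalized products *)

Section change_of_measure.
Context (R : realType) (alpha : R).

Lemma measurable_frakE_approx n :
  measurable_fun setT (fun v : seqs R => frakE_approx alpha v n).
Proof.
have mp k : measurable_fun setT (fun v : seqs R => v k `^ alpha).
  apply: (@measurableT_comp _ _ _ _ _ _ (@powR R ^~ alpha)) => //.
  exact: measurable_seqs_coord.
apply: measurable_funM; first by apply: measurable_funM.
by apply: measurableT_comp => //; exact: measurable_invr.
Qed.

Lemma measurable_frakE : measurable_fun setT (frakE alpha : seqs R -> R).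
Proof.
apply: (@measurable_fun_limn _ _ _ (fun n (v : seqs R) => frakE_approx alpha v n)) => n.
exact: measurable_frakE_approx.
Qed.

Lemma frakE_ge0 (v : nat -> R) : 0 <= frakE alpha v.
Proof.
have [cv|dv] := pselect (cvgn (frakE_approx alpha v)).
  apply: limr_ge => //; apply: nearW => n.
  by rewrite !mulr_ge0 ?invr_ge0 ?powR_ge0.
(* A divergent sequence has the default limit 0. *)
by rewrite /frakE dvgP.
Qed.

(** The normalization [1 + Sigma x 0] cancels between V_n and V_1. *)
Lemma frakE_approx_stick_seq (x : nat -> R) n : (forall i, 0 < x i < 1) ->
  cvgn (series (Sigma_term x 0)) ->
  frakE_approx alpha (stick_seq x) n =
  n.+1%:R * \prod_(i < n) unit_powR alpha setT (x i).
Proof.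
move=> x01 cx; have x0 i : 0 < x i by case/andP: (x01 i).
have S1 : 0 < 1 + Sigma x 0.
  rewrite ltr_pwDl//; apply: limr_ge => //; apply: nearW => N.
  by apply: sumr_ge0 => k _; apply: prodr_ge0 => i _; exact: ltW.
rewrite /frakE_approx /stick_seq big_ord0 -mulrA; congr (_ * _).
have p0 : 0 <= \prod_(i < n) x i by apply: prodr_ge0 => i _; exact: ltW.
have S0 := ltW S1.
rewrite mul1r powRM ?invr_ge0// mulfK ?gt_eqF ?powR_gt0 ?invr_gt0//.
elim: n p0 => [|n IH] p0; first by rewrite !big_ord0 powR1.
have pn0 : 0 <= \prod_(i < n) x i by apply: prodr_ge0 => i _; exact: ltW.
by rewrite !big_ord_recr/= powRM ?(ltW (x0 _))// IH// unit_powRT.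
Qed.

(** The ratio is E Y_m^r / r!, the total mass of the tilted measure before the limit. *)
Lemma cvg_rising_ratio r :
  (m.+1%:R ^+ r * m`!%:R / (m + r)`!%:R : R) @[m --> \oo] --> (1 : R).
Proof.
elim: r => [|r IH].
  under eq_fun do rewrite expr0 mul1r addn0 divff ?pnatr_eq0 -?lt0n ?fact_gt0//.
  exact: cvg_cst.
have E m : m.+1%:R ^+ r.+1 * m`!%:R / (m + r.+1)`!%:R =
    m.+1%:R ^+ r * m`!%:R / (m + r)`!%:R * (1 + r%:R / m.+1%:R)^-1 :> R.
  rewrite addnS factS natrM exprS.
  have f0 : (m + r)`!%:R != 0 :> R by rewrite pnatr_eq0 -lt0n fact_gt0.
  have mr0 : (m + r).+1%:R != 0 :> R by rewrite pnatr_eq0.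
  have m0 : m.+1%:R != 0 :> R by rewrite pnatr_eq0.
  have mrE : (m + r).+1%:R = m.+1%:R + r%:R :> R by rewrite -addSn natrD.
  rewrite mrE in mr0 *; move: f0 mr0 m0 {mrE}.
  move: ((m + r)`!%:R) (m.+1%:R) (r%:R) (m`!%:R) => F a b c F0 ab0 a0.
  have -> : 1 + b / a = (a + b) / a by rewrite mulrDl divff.
  rewrite invf_div; field.
  by rewrite ab0 F0.
rewrite (funext E) -[X in _ --> X]mulr1; apply: cvgM => //.
rewrite -[X in _ --> X]invr1; apply: cvgV; first exact: oner_neq0.
rewrite -[X in _ --> X]addr0; apply: cvgD; first exact: cvg_cst.
rewrite -[X in _ --> X](mulr0 r%:R); apply: cvgM; first exact: cvg_cst.
exact: cvg_harmonic.
Qed.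

End change_of_measure.

Section size_biasing.
Context d (T : measurableType d) (R : realType) (P : probability T R).
Variables (alpha : R) (r : nat) (alpha_gt0 : 0 < alpha) (r_gt0 : (0 < r)%N).
Variable X : nat -> {RV P >-> R}.
Hypothesis jX : joint_cdf_prod X.
Hypothesis bX : forall i, beta1_law P (i.+1%:R * alpha) (X i).
Hypothesis bXr : forall i, beta1_law P ((r + i.+1)%:R * alpha) (X (r + i)%N).

Local Notation Y := (normalized_prod alpha X).

Variable L : T -> R.
Hypotheses (mL : measurable_fun setT L) (L_ge0 : forall w, 0 <= L w).
Hypothesis YL : {ae P, forall w, Y n w @[n --> \oo] --> L w}.

Let Xr w : seqs R := fun i => X (r + i)%N w.

(** Factor by factor, the tilt x^(r alpha) turns the law of [X i] into that of [X (r + i)]. With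
    [n <= m] every constrained coordinate carries a tilting factor. *)
Lemma normalized_prodX_rectangle n B m : (n <= m)%N -> (forall i, measurable (B i)) ->
  (\int[P]_w (Y m w ^+ r * \1_(rectangle n B) (X ^~ w : seqs R))%:E =
   (r`!%:R * (m.+1%:R ^+ r * m`!%:R / (m + r)`!%:R))%:E *
   P [set w | rectangle n B (Xr w)])%E.
Proof.
move=> nm mB.
pose B' i := if (i < n)%N then B i else setT.
have mB' i : measurable (B' i) by rewrite /B'; case: ifP.
have p0 : 0 <= alpha * r%:R by rewrite mulr_ge0// ltW.
have E w : Y m w ^+ r * \1_(rectangle n B) (X ^~ w : seqs R) =
    m.+1%:R ^+ r * \prod_(i < m) unit_powR (alpha * r%:R) (B' i) (X i w).
  rewrite exprMn -mulrA; congr (_ * _); rewrite -prodrXl.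
  have -> : \1_(rectangle n B) (X ^~ w : seqs R) = \prod_(i < m) \1_(B' i) (X i w) :> R.
    have [wB|] := pselect (rectangle n B (X ^~ w)).
      rewrite [LHS]indicE mem_set// big1// => i _; rewrite indicE mem_set// /B'.
      by case: ifPn => // ni; exact: wB.
    move=> wB; rewrite [LHS]indicE memNset//.
    move/existsNP : wB => [i /not_implyP[ni Bi]].
    rewrite (bigD1 (Ordinal (leq_trans ni nm)))//= indicE memNset ?mul0r//.
    by rewrite /B' ni.
  rewrite -big_split/=; apply: eq_bigr => i _; rewrite unit_powRX//.
  rewrite /unit_powR -mulrA; congr (_ * _); rewrite setTI.
  by rewrite setIC !indicE in_setI; case: (_ \in _); case: (_ \in _); rewrite ?mulr1 ?mulr0.
under eq_integral do rewrite E EFinM.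
have mprod : measurable_fun setT
    (fun w => (\prod_(i < m) unit_powR (alpha * r%:R) (B' i) (X i w))%:E).
  apply/measurable_EFinP.
  exact: (measurable_prod_unit_powR X m (fun=> alpha * r%:R) mB').
have prod0 w : (0 <= (\prod_(i < m) unit_powR (alpha * r%:R) (B' i) (X i w))%:E)%E.
  rewrite lee_fin prodr_ge0// => i _.
  by case/andP: (unit_powR_itv01 (B' i) (X i w) p0).
have c0 : (0 <= (m.+1%:R ^+ r)%:E :> \bar R)%E by rewrite lee_fin exprn_ge0.
rewrite ge0_integralZl//.
have := @expectation_prod_unit_powR _ _ _ P X jX m (fun=> alpha * r%:R) B' (fun=> p0) mB'.
move=> ->.
have momE i : (\int[P]_w (unit_powR (alpha * r%:R) (B' i) (X i w))%:E =
    (i.+1%:R / (i.+1 + r)%:R)%:E * P (X (r + i)%N @^-1` B' i))%E.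
  have a0 : 0 < i.+1%:R * alpha by rewrite mulr_gt0.
  rewrite (beta1_moment a0 p0 (bX i) (mB' i)) bXr; last exact: mB'.
  have aE : i.+1%:R * alpha + alpha * r%:R = (r + i.+1)%:R * alpha.
    by rewrite natrD mulrDl addrC (mulrC alpha).
  rewrite aE; congr (_%:E * _)%E.
  by rewrite -mulf_div divff ?mulr1 ?gt_eqF// addnC.
under eq_bigr do rewrite momE.
rewrite big_split/= prodEFin.
have -> : (\prod_(i < m) P (X (r + i)%N @^-1` B' i) = P [set w | rectangle n B (Xr w)])%E.
  rewrite -(rectangle_prob (joint_cdf_prod_shift jX r) m mB').
  congr (P _); apply/seteqP; split => w H i ni.
    by have := H i (leq_trans ni nm); rewrite /B' ni.
  by rewrite /B'; case: ifPn => // im; exact: H.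
rewrite muleA -EFinM; congr (_%:E * _)%E.
have := prod_moment_cst R m r; set p := \prod_(_ < _) _ => pE.
have f0 : (m + r)`!%:R != 0 :> R by rewrite pnatr_eq0 -lt0n fact_gt0.
apply: (mulIf f0); rewrite -[LHS]mulrA pE.
by field.
Qed.

(* The pointwise factor L^r / r! is the limit of the likelihood ratios of the
   shifted sequence with respect to the original one. *)
Lemma size_biased_law (A : set (seqs R)) : measurable A ->
  P [set w | A (Xr w)] =
  (\int[P]_w ((L w ^+ r / r`!%:R)%:E * (\1_A (X ^~ w : seqs R))%:E))%E.
Proof.
move=> mA.
have mXr : measurable_fun setT Xr.
  exact: (measurable_seq_RV (fun i => X (r + i)%N)).
pose mXr' := isMeasurableFun.Build _ _ _ _ _ mXr.
pose sXr : {mfun T >-> seqs R} := HB.pack Xr mXr'.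
have mg : measurable_fun setT (fun w => L w ^+ r / r`!%:R).
  by apply: measurable_funM => //; exact: measurable_funX.
have g0 w : 0 <= L w ^+ r / r`!%:R by rewrite divr_ge0// exprn_ge0.
apply: (@finite_measure_unique_rectangle R (distribution P sXr)
  (weighted_image P mg g0 (measurable_seq_RV X))) => //.
  by rewrite -ge0_fin_numE// fin_num_measure.
move=> n B mB; rewrite /= /weighted_image.
have mS : measurable [set w | rectangle n B (X ^~ w)].
  rewrite -[X in measurable X]setTI; apply: measurable_seq_RV => //.
  exact: measurable_rectangle.
have lim1 := normalized_prodX_cvg alpha_gt0 jX bX mL L_ge0 YL r_gt0 mS.
have lim2 : (\int[P]_w (Y m w ^+ r * \1_[set w | rectangle n B (X ^~ w)] w)%:E)%E @[m --> \oo] -->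
    (r`!%:R%:E * P [set w | rectangle n B (Xr w)])%E.
  rewrite -(cvg_shiftn n).
  rewrite (_ : (fun _ => _) = fun m =>
      ((r`!%:R * ((m + n).+1%:R ^+ r * (m + n)`!%:R / (m + n + r)`!%:R))%:E *
       P [set w | rectangle n B (Xr w)])%E); last first.
    by apply/funext => m; rewrite -normalized_prodX_rectangle// leq_addl.
  apply: cvgeZr.
    rewrite fin_num_measure//; rewrite -[X in measurable X]setTI; apply: (mXr) => //.
    exact: measurable_rectangle.
  apply: cvg_EFin; first exact: nearW.
  rewrite -[X in _ --> X]mulr1; apply: cvgM; first exact: cvg_cst.
  rewrite (cvg_shiftn n (fun m => m.+1%:R ^+ r * m`!%:R / (m + r)`!%:R : R)).
  exact: cvg_rising_ratio.
have LE := cvg_unique _ lim1 lim2.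
have f0 : (r`!%:R : R) != 0 by rewrite pnatr_eq0 -lt0n fact_gt0.
transitivity ((r`!%:R^-1)%:E * (r`!%:R%:E * P [set w | rectangle n B (Xr w)]))%E.
  by rewrite muleA -EFinM mulVf// mul1e.
have mLS : measurable_fun setT
    (fun w => (L w ^+ r * \1_[set w | rectangle n B (X ^~ w)] w)%:E).
  apply/measurable_EFinP; apply: measurable_funM; first exact: measurable_funX.
  exact: measurable_indic.
have LS0 w : (0 <= (L w ^+ r * \1_[set w | rectangle n B (X ^~ w)] w)%:E)%E.
  by rewrite lee_fin mulr_ge0// exprn_ge0.
have rV0 : (0 <= (r`!%:R^-1)%:E :> \bar R)%E by rewrite lee_fin invr_ge0.
rewrite -LE// -ge0_integralZl//.
apply: eq_integral => w _; rewrite -!EFinM; congr (_%:E).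
by rewrite mulrCA mulrA.
Qed.

End size_biasing.

Theorem lemma5p1 (R : realType) (C alpha : R) (r : nat)
    (C_gt0 : 0 < C) (alpha_gt0 : 0 < alpha) (alpha_lt1 : alpha < 1)
    (r_gt0 : (0 < r)%N)
    (d : measure_display) (T : measurableType d) (P : probability T R)
    (Delta : nat -> {RV P >-> R}) (jumps : stable_jumps P C alpha Delta) :
  (* (i) *)
  (forall (d' : measure_display) (T' : measurableType d')
      (P' : probability T' R) (X : nat -> {RV P' >-> R}),
    independent P' X ->
    (forall i, beta1_law P' ((r + i.+1)%:R * alpha) (X i)) ->
    {ae P', forall w, forall n,
      cvgn (series (Sigma_term (X ^~ w) n)) /\
      stick_seq (X ^~ w) n =
        stick_factor (X ^~ w) n *
        \prod_(i < n) (1 - stick_factor (X ^~ w) i)} /\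
    has_law P' (fun w => stick_seq (X ^~ w)) (PD Delta r)) /\
  (* (ii) *)
  (forall (d1 : measure_display) (T1 : measurableType d1)
      (P1 : probability T1 R) (Vr : T1 -> seqs R)
      (d2 : measure_display) (T2 : measurableType d2)
      (P2 : probability T2 R) (V : T2 -> seqs R),
    has_law P1 Vr (PD Delta r) -> has_law P2 V (PD Delta 0) ->
    [/\ {ae P2, forall w,
          frakE_approx alpha (V w) n @[n --> \oo] --> frakE alpha (V w)},
        forall p : R, 1 <= p ->
          'E_P2[fun w =>
            (`|frakE_approx alpha (V w) n - frakE alpha (V w)| `^ p)%R]%E
            @[n --> \oo] --> 0%E
      & forall f : seqs R -> \bar R,
          measurable_fun setT f -> (forall v, (0 <= f v)%E) ->
          (\int[P1]_w f (Vr w) =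
           \int[P2]_w ((frakE alpha (V w) ^+ r / r`!%:R)%:E * f (V w)))%E]).
Proof.
pose Q i : {RV P >-> R} := jump_ratio Delta i.
have jQ : joint_cdf_prod Q := jump_ratio_joint_cdf_prod C_gt0 alpha_gt0 jumps.
have bQ i : beta1_law P (i.+1%:R * alpha) (Q i).
  exact: (jump_ratio_beta1_law C_gt0 alpha_gt0 jumps).
have jQr k : joint_cdf_prod (fun i => Q (k + i)%N).
  exact: (shifted_jump_ratio_joint_cdf_prod C_gt0 alpha_gt0 jumps).
have bQr k i : beta1_law P ((k + i.+1)%:R * alpha) (Q (k + i)%N).
  exact: (shifted_jump_ratio_beta1_law C_gt0 alpha_gt0 jumps).
have trimE k : {ae P, forall w,
    trimmed_ratio Delta k w = stick_seq (fun i => Q (k + i)%N w)}.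
  exact: (trimmed_ratio_stick_seq C_gt0 alpha_gt0 alpha_lt1 jumps).
have law_trim k : has_law P (trimmed_ratio Delta k) (PD Delta k).
  by split => //; exact: measurable_trimmed_ratio.
split.
  move=> d' T' P' X iX bX.
  have jX := independent_joint_cdf_prod iX.
  split.
    apply: filterS2 (beta_sequence_cvg alpha_gt0 jX bX alpha_lt1)
      (beta_sequence_in01 alpha_gt0 bX) => w cw Xw.
    by apply: stick_seqE => // i; case/andP: (Xw i).
  split.
    exact: (measurableT_comp (@measurable_stick_seq R) (measurable_seq_RV X)).
  move=> A mA.
  have mSA : measurable ((@stick_seq R : seqs R -> seqs R) @^-1` A).
    by rewrite -[X in measurable X]setTI; exact: measurable_stick_seq.
  have XQ i B : measurable B -> P' (X i @^-1` B) = P (Q (r + i)%N @^-1` B).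
    by move=> mB; rewrite bX// bQr.
  rewrite [LHS](sequence_law_unique jX (jQr r) XQ mSA).
  apply: ae_eq_measure.
  - rewrite -[X in measurable X]setTI.
    exact: (measurable_seq_RV (fun i => Q (r + i)%N)).
  - by rewrite -[X in measurable X]setTI; exact: measurable_trimmed_ratio.
  - by apply: filterS (trimE r) => w tw; rewrite /preimage/= tw.
move=> d1 T1 P1 Vr d2 T2 P2 V law1 law2.
(* Each claim about [V] depends on its law alone, so it is proved for [V0], where the ratios [Q] are
   at hand. *)
pose V0 := trimmed_ratio Delta 0.
pose L w := frakE alpha (V0 w).
have mL : measurable_fun setT L.
  exact: (measurableT_comp (measurable_frakE alpha) (measurable_trimmed_ratio Delta 0)).
have L_ge0 w : 0 <= L w by exact: frakE_ge0.
have approxE : {ae P, forall w n,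
    frakE_approx alpha (V0 w) n = normalized_prod alpha Q n w}.
  have cQ := beta_sequence_cvg alpha_gt0 (jQr 0%N) (bQr 0%N) alpha_lt1.
  have Q01 := beta_sequence_in01 alpha_gt0 (bQr 0%N).
  apply: filterS3 cQ Q01 (trimE 0%N) => w cw Qw tw n.
  by rewrite /V0 tw; apply: frakE_approx_stick_seq.
have YL : {ae P, forall w, normalized_prod alpha Q n w @[n --> \oo] --> L w}.
  apply: filterS2 approxE (normalized_prod_cvg alpha_gt0 jQ bQ) => w E cw.
  have -> : L w = limn (normalized_prod alpha Q ^~ w).
    by rewrite /L /frakE (_ : frakE_approx _ _ = normalized_prod alpha Q ^~ w)//; exact/funext.
  exact: cw.
split.
(* Convergence to [frakE] is mere convergence, and the sequences for which it holds form a
   measurable set; its probability is read off the law. *)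
- pose A := [set v : seqs R | cvgn (frakE_approx alpha v)].
  have mA : measurable A.
    apply: (@measurable_cvgn _ _ _ (fun n (v : seqs R) => frakE_approx alpha v n)) => n.
    exact: measurable_frakE_approx.
  have mVA : measurable (V @^-1` A).
    by rewrite -[X in measurable X]setTI; exact: law2.1.
  have V1 : P2 (V @^-1` A) = 1%E.
    have mV0A : measurable (V0 @^-1` A).
      by have := measurable_trimmed_ratio Delta 0 measurableT mA; rewrite setTI.
    rewrite (law2.2 _ mA) -((law_trim 0%N).2 _ mA) -(probability_setT P).
    apply: (ae_eq_measure mV0A (@measurableT _ _)).
    apply: filterS2 approxE YL => w E Yw; split => [//|_].
    apply/cvg_ex; exists (L w); rewrite (_ : frakE_approx _ _ = normalized_prod alpha Q ^~ w)//.
    exact/funext.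
  exists (~` (V @^-1` A)); split; first exact: measurableC.
    by rewrite probability_setC// V1 subee.
  by apply: subsetC => w.
- move=> p p1.
  have mh n : measurable_fun setT (fun v : seqs R =>
      (`|frakE_approx alpha v n - frakE alpha v| `^ p)%:E).
    apply/measurable_EFinP.
    apply: (@measurableT_comp _ _ _ _ _ _ (@powR R ^~ p)) => //.
    apply: measurableT_comp => //; apply: measurable_funB.
      exact: measurable_frakE_approx.
    exact: measurable_frakE.
  have h0 n (v : seqs R) : (0 <= (`|frakE_approx alpha v n - frakE alpha v| `^ p)%:E)%E.
    by rewrite lee_fin powR_ge0.
  have := normalized_prod_Lp alpha_gt0 jQ bQ mL L_ge0 YL p1.
  apply: cvg_trans; apply: near_eq_cvg; apply: nearW => n.
  rewrite unlock -(ge0_integral_has_law law2 (mh n) (h0 n)).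
  rewrite (ge0_integral_has_law (law_trim 0%N) (mh n) (h0 n)).
  apply: ae_eq_integral => //.
  + apply/measurable_EFinP.
    apply: (@measurableT_comp _ _ _ _ _ _ (@powR R ^~ p)) => //.
    apply: measurableT_comp => //; apply: measurable_funB => //.
    exact: measurable_normalized_prod.
  + exact: (measurableT_comp (mh n) (measurable_trimmed_ratio Delta 0)).
  + by apply: filterS approxE => w E _; rewrite -E.
move=> f mf f0.
pose g (v : seqs R) := ((frakE alpha v ^+ r / r`!%:R)%:E * f v)%E.
have mg : measurable_fun setT g.
  apply: emeasurable_funM => //; apply/measurable_EFinP.
  apply: measurable_funM => //; apply: measurable_funX; exact: measurable_frakE.
have g0 v : (0 <= g v)%E.
  by rewrite mule_ge0// lee_fin divr_ge0// exprn_ge0// frakE_ge0.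
rewrite -(ge0_integral_has_law law1 mf f0) (ge0_integral_has_law (law_trim r) mf f0).
rewrite -(ge0_integral_has_law law2 mg g0) (ge0_integral_has_law (law_trim 0%N) mg g0).
(* The same functional [F] of the ratios represents both sides: evaluated at the shifted ratios for
   [Vr], at all ratios for [V]. The identity is thus [size_biased_law] integrated against [F]. *)
pose F := (f \o (@stick_seq R : seqs R -> seqs R)).
have mF : measurable_fun setT F by exact: (measurableT_comp mf (@measurable_stick_seq R)).
have F0 v : (0 <= F v)%E by exact: f0.
have mQr k := measurable_seq_RV (fun i => Q (k + i)%N).
transitivity (\int[P]_w F (fun i => Q (r + i)%N w))%E.
  apply: ae_eq_integral => //.
  - exact: (measurableT_comp mf (measurable_trimmed_ratio Delta r)).
  - exact: (measurableT_comp mF (mQr r)).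
  - by apply: filterS (trimE r) => w tw _; rewrite tw.
pose mXr := isMeasurableFun.Build _ _ _ _ _ (mQr r).
pose sXr : {mfun T >-> seqs R} := HB.pack (fun w => (fun i => Q (r + i)%N w) : seqs R) mXr.
rewrite -[LHS](ge0_integral_distribution sXr mF F0).
have mG : measurable_fun setT (fun w => L w ^+ r / r`!%:R).
  by apply: measurable_funM => //; exact: measurable_funX.
have G0 w : 0 <= L w ^+ r / r`!%:R by rewrite divr_ge0// exprn_ge0.
rewrite (ge0_integral_weighted_image (mu := P) mG G0 (mQr 0%N) _ mF F0); last first.
  by move=> A mA; exact: (size_biased_law alpha_gt0 r_gt0 jQ bQ (bQr r) mL L_ge0 YL).
apply: ae_eq_integral; first exact: measurableT.
- apply: emeasurable_funM; first exact/measurable_EFinP.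
  exact: (measurableT_comp mF (mQr 0%N)).
- exact: (measurableT_comp mg (measurable_trimmed_ratio Delta 0)).
- by apply: filterS (trimE 0%N) => w tw _; rewrite /g /L /V0 /F /= tw.
Qed.
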